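(* Let $G$ and $H$ be countable discrete groups. Let $H$ be a Poincaré duality group over a commutative ring $R$ with unit. Assume that there is a coarse embedding $\varphi:G\to H$ which is not a coarse equivalence. If $\mathrm{hd}_R\,G<\infty$, then $\mathrm{hd}_R\,G<\mathrm{cd}_R\,H$. If, in addition, $G$ is of type $FP_\infty$ (i.e. $FP_n$ for all $n$) over $R$, then $\mathrm{cd}_R\,G<\mathrm{cd}_R\,H$. In particular, every self coarse embedding of a Poincaré duality group over $R$ (i.e. every coarse embedding of such a group into itself) must be a coarse equivalence.
   Context: All groups are countable and discrete. A map $\varphi:G\to H$ is a coarse map if it has finite point preimages and for every $S\subseteq G\times G$ with $\{st^{-1}:(s,t)\in S\}$ finite, $\{\varphi(s)\varphi(t)^{-1}:(s,t)\in S\}$ is finite. It is a coarse embedding if for every $S\subseteq G\times G$, $\{st^{-1}:(s,t)\in S\}$ is finite iff $\{\varphi(s)\varphi(t)^{-1}:(s,t)\in S\}$ is finite. Maps $\varphi,\phi$ are close ($\sim$) if $\{\varphi(x)\phi(x)^{-1}:x\in G\}$ is finite. A coarse map $\varphi:G\to H$ is a coarse equivalence if there is a coarse map $\psi:H\to G$ with $\psi\circ\varphi\sim\mathrm{id}_G$, $\varphi\circ\psi\sim\mathrm{id}_H$. A group $H$ is a Poincaré duality group over $R$ if there are a right $RH$-module $C$ with $C\cong R$ as $R$-modules and an integer $n\ge0$ with natural isomorphisms $H^k(H,A)\cong H_{n-k}(H,C\otimes_RA)$ for all $k\in\mathbb Z$ and all $RH$-modules $A$ (diagonal action on $C\otimes_RA$).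 $\mathrm{hd}_R\,G$ and $\mathrm{cd}_R\,G$ are the homological and cohomological dimensions over $R$, i.e. the suprema of all $n$ with $H_n(G,A)\ncong\{0\}$, resp. $H^n(G,A)\ncong\{0\}$, for some $RG$-module $A$. $G$ is of type $FP_n$ over $R$ if the trivial $RG$-module $R$ has a projective resolution $\dots\to P_1\to P_0\to R\to0$ with $P_i$ finitely generated for $0\le i\le n$. *)

(* Defs.v *)
From HB Require Import structures.
From mathcomp Require Import all_boot all_order all_algebra.
From mathcomp Require Import boolp classical_sets functions cardinality.
From mathcomp Require Import constructive_ereal.
(* The notations of monalg are incompatible with those of classical_sets. *)
From mathcomp Require Import -(notations) monalg.
From mathcomp Require Import finmap.

Set Implicit Arguments.
Unset Strict Implicit.
Unset Printing Implicit Defensive.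

Import Order.TTheory GRing.Theory Num.Theory.

Local Open Scope fset_scope.
Local Open Scope classical_set_scope.
Local Open Scope quotient_scope.
Local Open Scope ring_scope.

Section Coarse.
Variables G H : groupType.
Implicit Types (phi : G -> H) (S : set (G * G)).

Definition coarse_map phi : Prop :=
  (forall h, finite_set (phi @^-1` [set h])) /\
  (forall S, finite_set [set (p.1 * p.2^-1)%g | p in S] ->
             finite_set [set (phi p.1 * (phi p.2)^-1)%g | p in S]).

Definition coarse_embedding phi : Prop :=
  forall S, finite_set [set (p.1 * p.2^-1)%g | p in S] <->
            finite_set [set (phi p.1 * (phi p.2)^-1)%g | p in S].

Definition close phi (psi : G -> H) : Prop :=
  finite_set [set (phi x * (psi x)^-1)%g | x in [set: G]].

End Coarse.

Definition coarse_equivalence (G H : groupType) (phi : G -> H) : Prop :=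
  coarse_map phi /\
  exists psi : H -> G,
    [/\ coarse_map psi, close (psi \o phi) id & close (phi \o psi) id].

Lemma zmod_morphismD (U V : zmodType) (f : U -> V) :
  zmod_morphism f -> {morph f : x y / x + y}.
Proof.
move=> fB; pose F : {additive U -> V} :=
  HB.pack f (GRing.isZmodMorphism.Build _ _ f fB).
exact: (raddfD F).
Qed.

(* [malg K A] is the group of finitely supported functions from K to A, and
   [mkmalgU k a] is the function with value a at k and 0 elsewhere. *)

Section MalgExt.
Variables (K : choiceType) (A B : zmodType).
Implicit Types (h : K -> A -> B) (x y : malg K A).

Definition malg_ext h x : B := \sum_(k <- msupp x) h k (mcoeff k x).

Variable h : K -> A -> B.
Hypothesis hB : forall k, zmod_morphism (h k).

Let h0 k : h k 0 = 0. Proof. by rewrite -(subrr 0) hB subrr. Qed.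

Lemma malg_extEw (d : {fset K}) x : (msupp x `<=` d)%fset ->
  malg_ext h x = \sum_(k <- d) h k (mcoeff k x).
Proof.
by move=> le; apply: big_fset_incl => // k _ /mcoeff_outdom ->.
Qed.

Lemma malg_ext_is_zmod_morphism : zmod_morphism (malg_ext h).
Proof.
move=> x y; pose d := (msupp x `|` msupp y)%fset.
rewrite (@malg_extEw d) ?msuppB_le // (@malg_extEw d x) ?fsubsetUl //.
rewrite (@malg_extEw d y) ?fsubsetUr // -sumrB.
by apply: eq_bigr => k _; rewrite mcoeffB hB.
Qed.

Lemma malg_extU k a : malg_ext h (mkmalgU k a) = h k a.
Proof. by rewrite (malg_extEw msuppU_le) big_seq_fset1 mcoeffUU. Qed.

End MalgExt.

Lemma malg_morphism_eq (K : choiceType) (A B : zmodType) (f g : malg K A -> B) :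
  zmod_morphism f -> zmod_morphism g ->
  (forall k a, f (mkmalgU k a) = g (mkmalgU k a)) -> f =1 g.
Proof.
move=> fB gB fg x.
pose F : {additive _ -> _} :=
  HB.pack f (GRing.isZmodMorphism.Build _ _ f fB).
pose G : {additive _ -> _} :=
  HB.pack g (GRing.isZmodMorphism.Build _ _ g gB).
rewrite (monalgE x) -[f _]/(F _) -[g _]/(G _) !raddf_sum.
by apply: eq_bigr => k _; apply: fg.
Qed.

Definition group_ring (R : comNzRingType) (G : groupType) : Type := malg G R.

Section GroupRing.
Variables (R : comNzRingType) (G : groupType).
Local Notation RG := (group_ring R G).

HB.instance Definition _ := GRing.Zmodule.copy RG (malg G R).

(* the element r g of RG *)
Definition gmon (r : R) (g : G) : RG := mkmalgU g r.

Definition group_ring_one : RG := gmon 1 1%g.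
Definition group_ring_mul (x y : RG) : RG :=
  malg_ext (fun g r => malg_ext (fun h s => gmon (r * s) (g * h)%g) y) x.

Lemma group_ring_morphism_eq (B : zmodType) (f f' : RG -> B) :
  zmod_morphism f -> zmod_morphism f' ->
  (forall r g, f (gmon r g) = f' (gmon r g)) -> f =1 f'.
Proof. move=> fB f'B ff'; exact: (malg_morphism_eq fB f'B (fun g r => ff' r g)). Qed.

Lemma gmonB g : zmod_morphism (gmon^~ g).
Proof. by move=> r s; rewrite /gmon monalgUB. Qed.

Let hB g r h : zmod_morphism (fun s => gmon (r * s) (g * h)%g).
Proof. by move=> s t; rewrite mulrBr gmonB. Qed.

Let mulBr x : zmod_morphism (group_ring_mul x).
Proof.
move=> y z; have mulE w : group_ring_mul x w = \sum_(g <- msupp x)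
    malg_ext (fun h s => gmon (mcoeff g x * s) (g * h)%g) w by [].
rewrite !mulE -sumrB; apply: eq_bigr => g _.
by rewrite (malg_ext_is_zmod_morphism (hB g _)).
Qed.

Let mulBl y : zmod_morphism (group_ring_mul^~ y).
Proof.
apply: malg_ext_is_zmod_morphism => g r s.
rewrite /malg_ext -sumrB; apply: eq_bigr => h _.
by rewrite mulrBl gmonB.
Qed.

Let mulUU r s g h :
  group_ring_mul (gmon r g) (gmon s h) = gmon (r * s) (g * h)%g.
Proof.
rewrite /group_ring_mul malg_extU ?malg_extU // => k t u.
rewrite /malg_ext -sumrB; apply: eq_bigr => l _.
by rewrite mulrBl gmonB.
Qed.

Let mulA : associative group_ring_mul.
Proof.
pose m := group_ring_mul; move=> x y z.
apply: (@group_ring_morphism_eq _ (fun x => m x (m y z)) (fun x => m (m x y) z)).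
- exact: mulBl.
- by move=> u v; rewrite /m !mulBl.
move=> r g; move: y.
apply: (@group_ring_morphism_eq _ (fun y => m _ (m y z)) (fun y => m (m _ y) z)).
- by move=> u v; rewrite /m mulBl mulBr.
- by move=> u v; rewrite /m mulBr mulBl.
move=> s h; move: z.
apply: (@group_ring_morphism_eq _ (fun z => m _ (m _ z)) (fun z => m (m _ _) z)).
- by move=> u v; rewrite /m !mulBr.
- exact: mulBr.
move=> t k; rewrite /m.
by rewrite !mulUU mulrA mulgA.
Qed.

Let mul1 : left_id group_ring_one group_ring_mul.
Proof.
apply: group_ring_morphism_eq => [u v|//|r g]; first by rewrite mulBr.
by rewrite mulUU mul1r mul1g.
Qed.

Let mulr1_ : right_id group_ring_one group_ring_mul.
Proof.
apply: group_ring_morphism_eq => [u v|//|r g]; first by rewrite mulBl.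
by rewrite mulUU mulr1 mulg1.
Qed.

Let mulDl : left_distributive group_ring_mul +%R.
Proof. by move=> x y z; apply: (zmod_morphismD (mulBl z)). Qed.

Let mulDr : right_distributive group_ring_mul +%R.
Proof. by move=> x y z; apply: (zmod_morphismD (mulBr x)). Qed.

Let one_neq0 : group_ring_one != 0.
Proof. by rewrite monalgU_eq0 oner_eq0. Qed.

HB.instance Definition _ := GRing.Zmodule_isNzRing.Build RG
  mulA mul1 mulr1_ mulDl mulDr one_neq0.

Lemma gmonM r s g h : gmon r g * gmon s h = gmon (r * s) (g * h)%g.
Proof. exact: mulUU. Qed.

Lemma gmon11 : gmon 1 1%g = 1. Proof. by []. Qed.

End GroupRing.

(* [mact a r g] is the action of the element r g of RG; scalars of R act
   through r 1. *)
Record monomial_action (R : comNzRingType) (G : groupType) (M : zmodType) :=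
  MonomialAction {
    mact :> R -> G -> M -> M;
    mactBl : forall g m, zmod_morphism (fun r => mact r g m);
    mactBr : forall r g, zmod_morphism (mact r g);
    mact11 : forall m, mact 1 1%g m = m;
    mactM : forall r s g h m,
      mact r g (mact s h m) = mact (r * s) (g * h)%g m
  }.

Definition action_module (R : comNzRingType) (G : groupType) (M : zmodType)
  (a : monomial_action R G M) : Type := M.

Section ActionModule.
Variables (R : comNzRingType) (G : groupType) (M : zmodType).
Variable a : monomial_action R G M.

HB.instance Definition _ := GRing.Zmodule.copy (action_module a) M.

Definition action_scale (x : group_ring R G) (m : action_module a) :
    action_module a :=
  malg_ext (fun g r => a r g m) x.

Let scaleBl m : zmod_morphism (action_scale^~ m).
Proof.
exact: (malg_ext_is_zmod_morphism (fun g : G => mactBl a g m)).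
Qed.

Let scaleBr x : zmod_morphism (action_scale x).
Proof.
move=> m n; rewrite /action_scale /malg_ext -sumrB.
by apply: eq_bigr => g _; apply: (mactBr a).
Qed.

Let scaleU r g m : action_scale (gmon r g) m = a r g m.
Proof. 
exact: (malg_extU (fun g : G => mactBl a g m)).
Qed.

Let scaleA x y m : action_scale x (action_scale y m) = action_scale (x * y) m.
Proof.
pose sc := action_scale; move: x.
apply: (@group_ring_morphism_eq _ _ _ (fun x => sc x (sc y m))
  (fun x => sc (x * y) m)).
- exact: scaleBl.
- by move=> u v; rewrite /sc mulrBl scaleBl.
move=> r g; move: y.
apply: (@group_ring_morphism_eq _ _ _ (fun y => sc _ (sc y m))
  (fun y => sc (_ * y) m)).
- by move=> u v; rewrite /sc scaleBl scaleBr.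
- by move=> u v; rewrite /sc mulrBr scaleBl.
move=> s h; rewrite /sc.
by rewrite gmonM !scaleU mactM.
Qed.

Let scale1 : left_id 1 action_scale.
Proof. by move=> m; rewrite -gmon11 scaleU mact11. Qed.

Let scaleDr : right_distributive action_scale +%R.
Proof. by move=> x m n; apply: zmod_morphismD (scaleBr x) _ _. Qed.

Let scaleDl m : {morph action_scale^~ m : x y / x + y}.
Proof. exact: zmod_morphismD (scaleBl m). Qed.

HB.instance Definition _ := GRing.Zmodule_isLmodule.Build (group_ring R G)
  (action_module a) scaleA scale1 scaleDr scaleDl.

Lemma action_moduleE r g (m : action_module a) : gmon r g *: m = a r g m.
Proof. exact: scaleU. Qed.

End ActionModule.

Section TrivialModule.
Variables (R : comNzRingType) (G : groupType).

Let act (r : R) (g : G) (m : R) : R := r * m.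

Let actBl g m : zmod_morphism (fun r => act r g m).
Proof. by move=> r s; rewrite /act mulrBl. Qed.
Let actBr r g : zmod_morphism (act r g).
Proof. by move=> m n; rewrite /act mulrBr. Qed.
Let act11 m : act 1 1%g m = m. Proof. exact: mul1r. Qed.
Let actM r s g h m : act r g (act s h m) = act (r * s) (g * h)%g m.
Proof. exact: mulrA. Qed.

Definition trivial_action : monomial_action R G R :=
  MonomialAction actBl actBr act11 actM.

Definition trivial_module : lmodType (group_ring R G) :=
  action_module trivial_action.

End TrivialModule.

Section Tensor.
Variables (R : comNzRingType) (G : groupType).
Local Notation RG := (group_ring R G).

(* Right RG-modules are modules over the converse ring; [ract c x] is c x. *)
Definition ract (C : lmodType RG^c) (c : C) (x : RG) : C := (x : RG^c) *: c.

Lemma ractM (C : lmodType RG^c) (c : C) x y :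
  ract (ract c x) y = ract c (x * y).
Proof. exact: scalerA. Qed.

Section Def.
Variables (C : lmodType RG^c) (A : lmodType RG).

(* the relations between the generators (c, a) of the free abelian group on
   C * A which define C (x)_R A; R acts through the elements r 1 of RG *)
Inductive tensor_rel : malg (C * A)%type int -> Prop :=
| tensor_rel0 : tensor_rel 0
| tensor_relB x y : tensor_rel x -> tensor_rel y -> tensor_rel (x - y)
| tensor_rel_addl c c' a : tensor_rel
    (mkmalgU (c + c', a) 1 - mkmalgU (c, a) 1 - mkmalgU (c', a) 1)
| tensor_rel_addr c a a' : tensor_rel
    (mkmalgU (c, a + a') 1 - mkmalgU (c, a) 1 - mkmalgU (c, a') 1)
| tensor_rel_bal r c a : tensor_rel
    (mkmalgU (ract c (gmon r 1%g), a) 1 - mkmalgU (c, gmon r 1%g *: a) 1).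

Definition tensor_pred : {pred malg (C * A)%type int} :=
  fun x => `[< tensor_rel x >].

Lemma tensor_pred_zmod_closed : zmod_closed tensor_pred.
Proof.
split=> [|x y /asboolP x0 /asboolP y0]; apply/asboolP.
  exact: tensor_rel0.
exact: tensor_relB.
Qed.

HB.instance Definition _ :=
  GRing.isZmodClosed.Build _ tensor_pred tensor_pred_zmod_closed.

Definition tensor_group : zmodType := Quotient.quot tensor_pred.

Definition tensor_class (x : malg (C * A)%type int) : tensor_group :=
  \pi_(Quotient.quot tensor_pred) x.

Definition tensor (c : C) (a : A) : tensor_group :=
  tensor_class (mkmalgU (c, a) 1).

Lemma tensor_class_eq x y :
  tensor_class x = tensor_class y <-> tensor_rel (x - y).
Proof.
split=> [/eqP|xy]; last apply/eqP; rewrite /tensor_class eqmodE /=.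
  by move/asboolP.
by apply/asboolP.
Qed.

Lemma tensor_classB : zmod_morphism tensor_class.
Proof. exact: (raddfB \pi_(Quotient.quot tensor_pred)). Qed.

Lemma tensor_class_repr (x : tensor_group) : tensor_class (repr x) = x.
Proof. exact: reprK. Qed.

Lemma tensorDl c c' a : tensor (c + c') a = tensor c a + tensor c' a.
Proof.
rewrite -(zmod_morphismD tensor_classB); apply/tensor_class_eq.
by rewrite opprD addrA; apply: tensor_rel_addl.
Qed.

Lemma tensorDr c a a' : tensor c (a + a') = tensor c a + tensor c a'.
Proof.
rewrite -(zmod_morphismD tensor_classB); apply/tensor_class_eq.
by rewrite opprD addrA; apply: tensor_rel_addr.
Qed.

Lemma tensorBr c : zmod_morphism (tensor c).
Proof. by move=> a b; apply: (addIr (tensor c b)); rewrite -tensorDr !subrK. Qed.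

Lemma tensor_bal r c a :
  tensor (ract c (gmon r 1%g)) a = tensor c (gmon r 1%g *: a).
Proof. by apply/tensor_class_eq; apply: tensor_rel_bal. Qed.

Lemma tensor_morphism_eq (B : zmodType) (f g : tensor_group -> B) :
  zmod_morphism f -> zmod_morphism g ->
  (forall c a, f (tensor c a) = g (tensor c a)) -> f =1 g.
Proof.
move=> fB gB fg x.
pose F : {additive _ -> _} :=
  HB.pack f (GRing.isZmodMorphism.Build _ _ f fB).
pose H : {additive _ -> _} :=
  HB.pack g (GRing.isZmodMorphism.Build _ _ g gB).
pose T : {additive _ -> _} := HB.pack tensor_class
  (GRing.isZmodMorphism.Build _ _ tensor_class tensor_classB).
rewrite -[x]tensor_class_repr (monalgE (repr x)) -[f _]/(F (T _)).
rewrite -[g _]/(H (T _)) !raddf_sum.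
apply: eq_bigr => -[c a] _; move: (mcoeff _ _) => n.
have -> : mkmalgU (c, a) n = (mkmalgU (c, a) 1) *~ n :> malg (C * A)%type int.
  by rewrite -raddfMz intz.
by rewrite !raddfMz; congr (_ *~ n); apply: fg.
Qed.

End Def.

Section Map.
Variables (C : lmodType RG^c) (A B : lmodType RG) (p : C -> C) (q : A -> B).

Definition tensor_push (x : malg (C * A)%type int) : malg (C * B)%type int :=
  malg_ext (fun ca n => mkmalgU (p ca.1, q ca.2) n) x.

(* p (x) q; well defined only for R-linear p and q *)
Definition tensor_map (x : tensor_group C A) : tensor_group C B :=
  tensor_class (tensor_push (repr x)).

Let pushB : zmod_morphism tensor_push.
Proof. by apply: malg_ext_is_zmod_morphism => ca n m; rewrite monalgUB. Qed.

Let pushU c a : tensor_push (mkmalgU (c, a) 1) = mkmalgU (p c, q a) 1.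
Proof. by rewrite /tensor_push malg_extU // => ca n m; rewrite monalgUB. Qed.

Hypothesis pD : {morph p : x y / x + y}.
Hypothesis qD : {morph q : x y / x + y}.
Hypothesis pZ : forall r c, p (ract c (gmon r 1%g)) = ract (p c) (gmon r 1%g).
Hypothesis qZ : forall r a, q (gmon r 1%g *: a) = gmon r 1%g *: q a.

Let push_rel x : tensor_rel x -> tensor_rel (tensor_push x).
Proof.
elim=> [|{}x y _ IHx _ IHy|c c' a|c a a'|r c a].
- by rewrite -(subrr 0) pushB subrr; apply: tensor_rel0.
- by rewrite pushB; apply: tensor_relB.
- by rewrite !pushB !pushU pD; apply: tensor_rel_addl.
- by rewrite !pushB !pushU qD; apply: tensor_rel_addr.
- by rewrite !pushB !pushU pZ qZ; apply: tensor_rel_bal.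
Qed.

Let map_class x :
  tensor_map (tensor_class x) = tensor_class (tensor_push x).
Proof.
apply/tensor_class_eq; rewrite -pushB; apply: push_rel.
by apply/tensor_class_eq; rewrite tensor_class_repr.
Qed.

Lemma tensor_mapE c a : tensor_map (tensor c a) = tensor (p c) (q a).
Proof. by rewrite map_class pushU. Qed.

Lemma tensor_map_is_zmod_morphism : zmod_morphism tensor_map.
Proof.
move=> x y; rewrite -[x]tensor_class_repr -[y]tensor_class_repr -tensor_classB !map_class.
by rewrite pushB tensor_classB.
Qed.

End Map.

Section Action.
Variables (C : lmodType RG^c) (A : lmodType RG).

(* diagonal action: r g (c (x) a) = c g^-1 (x) r g a *)
Let act (r : R) (g : G) : tensor_group C A -> tensor_group C A :=
  tensor_map (fun c => ract c (gmon 1 g^-1%g)) (fun a => gmon r g *: a).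

Let pD g : {morph (fun c : C => ract c (gmon 1 g^-1%g)) : x y / x + y}.
Proof. by move=> x y; apply: scalerDr. Qed.

Let qD r g : {morph (fun a : A => gmon r g *: a) : x y / x + y}.
Proof. by move=> x y; apply: scalerDr. Qed.

Let pZ g r (c : C) : ract (ract c (gmon r 1%g)) (gmon 1 g^-1%g) =
  ract (ract c (gmon 1 g^-1%g)) (gmon r 1%g).
Proof. by rewrite !ractM !gmonM mul1r mulr1 mul1g mulg1. Qed.

Let qZ r g s (a : A) :
  gmon r g *: (gmon s 1%g *: a) = gmon s 1%g *: (gmon r g *: a).
Proof. by rewrite !scalerA !gmonM mul1g mulg1 mulrC. Qed.

Let actE r g c a :
  act r g (tensor c a) = tensor (ract c (gmon 1 g^-1%g)) (gmon r g *: a).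
Proof. exact: tensor_mapE. Qed.

Let actBr r g : zmod_morphism (act r g).
Proof. exact: tensor_map_is_zmod_morphism. Qed.

Let actBl g m : zmod_morphism (fun r => act r g m).
Proof.
move=> r s; move: m; apply: tensor_morphism_eq => [//|m n|c a].
  by rewrite !actBr !opprB addrACA [RHS]addrACA; congr (_ + _); rewrite addrC.
by rewrite !actE gmonB scalerBl tensorBr.
Qed.

Let act11 m : act 1 1%g m = m.
Proof.
move: m; apply: tensor_morphism_eq => [//|//|c a].
by rewrite actE invg1 gmon11 scale1r [ract _ _]scale1r.
Qed.

Let actM r s g h m : act r g (act s h m) = act (r * s) (g * h)%g m.
Proof.
move: m; apply: tensor_morphism_eq => [m n|//|c a]; first by rewrite !actBr.
by rewrite !actE ractM scalerA !gmonM mul1r invgM.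
Qed.

Definition tensor_action : monomial_action R G (tensor_group C A) :=
  MonomialAction actBl actBr act11 actM.

Definition tensor_module : lmodType RG := action_module tensor_action.

Lemma tensor_moduleE r g c a :
  gmon r g *: (tensor c a : tensor_module) =
  tensor (ract c (gmon 1 g^-1%g)) (gmon r g *: a).
Proof. by rewrite action_moduleE; apply: actE. Qed.

End Action.

Section Functor.
Variables (C : lmodType RG^c) (A B : lmodType RG) (f : {linear A -> B}).

Definition tensor_module_map (x : tensor_module C A) : tensor_module C B :=
  tensor_map id f x.

Let mapB : zmod_morphism tensor_module_map.
Proof.
by apply: tensor_map_is_zmod_morphism => // [x y|r a]; rewrite (raddfD, linearZ).
Qed.

Let mapE c a : tensor_module_map (tensor c a) = tensor c (f a).
Proof.
by apply: tensor_mapE => // [x y|r b]; rewrite (raddfD, linearZ).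
Qed.

Let mapZ x : {morph tensor_module_map : m / x *: m}.
Proof.
move=> m; move: x; apply: malg_morphism_eq => [x y|x y|g r].
- by rewrite scalerBl mapB.
- by rewrite scalerBl.
move: m; apply: tensor_morphism_eq => [m n|m n|c a].
- by rewrite [_ *: _]scalerBr mapB.
- by rewrite mapB [_ *: _]scalerBr.
by rewrite mapE -[mkmalgU g r]/(gmon r g) !tensor_moduleE mapE linearZ.
Qed.

HB.instance Definition _ :=
  GRing.isZmodMorphism.Build (tensor_module C A) (tensor_module C B)
    tensor_module_map mapB.
HB.instance Definition _ :=
  GRing.isScalable.Build RG (tensor_module C A) (tensor_module C B) *:%R
    tensor_module_map mapZ.

End Functor.

End Tensor.

Arguments tensor_module_map {R G} C {A B} f x.

(* homology of U --f--> V --g--> W at V, i.e. ker g modulo the image of f *)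
Section Homology.
Variables (U V W : zmodType) (f : {additive U -> V}) (g : {additive V -> W}).

Definition ker_pred : {pred V} := fun x => g x == 0.

Lemma ker_pred_zmod_closed : zmod_closed ker_pred.
Proof.
split=> [|x y /eqP x0 /eqP y0]; apply/eqP; first exact: raddf0.
by rewrite raddfB x0 y0 subrr.
Qed.

HB.instance Definition _ :=
  GRing.isZmodClosed.Build V ker_pred ker_pred_zmod_closed.

Definition kernel : Type := {x : V | x \in ker_pred}.
HB.instance Definition _ := SubChoice.on kernel.
HB.instance Definition _ := [SubChoice_isSubZmodule of kernel by <:].

Definition im_pred : {pred kernel} := fun x => `[< exists u, val x = f u >].

Lemma im_pred_zmod_closed : zmod_closed im_pred.
Proof.
split=> [|x y /asboolP[u xu] /asboolP[v yv]]; apply/asboolP.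
  by exists 0; rewrite !raddf0.
by exists (u - v); rewrite [LHS]raddfB [RHS]raddfB; congr (_ - _).
Qed.

HB.instance Definition _ :=
  GRing.isZmodClosed.Build kernel im_pred im_pred_zmod_closed.

Definition homology : zmodType := Quotient.quot im_pred.

Definition homology_class (x : kernel) : homology :=
  \pi_(Quotient.quot im_pred) x.

Lemma homology_class_eq x y :
  homology_class x = homology_class y <-> exists u, val x - val y = f u.
Proof.
rewrite -raddfB; split=> [/eqP|xy]; last apply/eqP;
  rewrite /homology_class eqmodE /=.
  by move/asboolP.
by apply/asboolP.
Qed.

Lemma homology_class_repr (x : homology) : homology_class (repr x) = x.
Proof. exact: reprK. Qed.

End Homology.

Section HomologyMap.
Variables (U V W U' V' W' : zmodType).
Variables (f : {additive U -> V}) (g : {additive V -> W}).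
Variables (f' : {additive U' -> V'}) (g' : {additive V' -> W'}).
Variable phi : V -> V'.

(* meaningful only for phi as in homology_mapE *)
Definition homology_map (x : homology f g) : homology f' g' :=
  homology_class f' (insubd (0 : kernel g') (phi (val (repr x)))).

Lemma homology_mapE (x : kernel g) :
  zmod_morphism phi -> (forall v, g v = 0 -> g' (phi v) = 0) ->
  (forall u, exists u', phi (f u) = f' u') ->
  homology_map (homology_class f x) =
    homology_class f' (insubd (0 : kernel g') (phi (val x))).
Proof.
move=> phiB phiZ phiI; apply/homology_class_eq.
have valE (y : kernel g) :
    val (insubd (0 : kernel g') (phi (val y))) = phi (val y).
  by apply: insubdK; apply/eqP/phiZ/eqP/(valP y).
have /homology_class_eq[u xu] := homology_class_repr (homology_class f x).
by rewrite !valE -phiB xu; apply: phiI.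
Qed.

End HomologyMap.

(* (g_1, ..., g_{n+1}) is sent to (g_2, ..., g_{n+1}) if i = 0, to
   (g_1, ..., g_i g_{i+1}, ..., g_{n+1}) if 0 < i < n+1, and to
   (g_1, ..., g_n) if i = n+1. *)
Definition face (G : groupType) (n i : nat) (s : n.+1.-tuple G) : n.-tuple G :=
  [tuple if (j.+1 < i)%N then nth 1%g s j
         else if j.+1 == i then (nth 1%g s j * nth 1%g s j.+1)%g
         else nth 1%g s j.+1 | j < n].

Section GroupHomology.
Variables (R : comNzRingType) (G : groupType).
Local Notation RG := (group_ring R G).

Definition cochain (n : nat) (A : lmodType RG) : zmodType := n.-tuple G -> A.

Definition chain (n : nat) (A : lmodType RG) : zmodType := malg (n.-tuple G) A.

Section Differentials.
Variable A : lmodType RG.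

(* (d f)(g_1, ..., g_{n+1}) = g_1 f(g_2, ..., g_{n+1})
     + sum_{0 < i < n+1} (-1)^i f(..., g_i g_{i+1}, ...)
     + (-1)^{n+1} f(g_1, ..., g_n) *)
Definition coboundary n (f : cochain n A) : cochain n.+1 A := fun s =>
  \sum_(i < n.+2)
     (-1) ^+ i *: (if i == ord0 then gmon 1 (thead s) *: f (face i s)
                   else f (face i s)).

(* d (a (x) (g_1, ..., g_{n+1})) = g_1^-1 a (x) (g_2, ..., g_{n+1})
     + sum_{0 < i < n+1} (-1)^i a (x) (..., g_i g_{i+1}, ...)
     + (-1)^{n+1} a (x) (g_1, ..., g_n): the left module A is made a right
   module by a g = g^-1 a. *)
Definition boundary n (x : chain n.+1 A) : chain n A :=
  malg_ext (fun s a => \sum_(i < n.+2)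
    mkmalgU (face i s)
      ((-1) ^+ i *: (if i == ord0 then gmon 1 (thead s)^-1%g *: a else a))) x.

Lemma coboundaryB n : zmod_morphism (@coboundary n).
Proof.
move=> f f'; apply/funext => s.
rewrite -[RHS]/(coboundary f s - coboundary f' s) /coboundary -sumrB.
apply: eq_bigr => i _.
by rewrite -scalerBr; congr (_ *: _); case: ifP => // _; rewrite -scalerBr.
Qed.

Lemma boundaryB n : zmod_morphism (@boundary n).
Proof.
apply: malg_ext_is_zmod_morphism => s a a'; rewrite -sumrB.
apply: eq_bigr => i _; rewrite -monalgUB -scalerBr.
by congr (mkmalgU _ (_ *: _)); case: ifP => // _; rewrite -scalerBr.
Qed.

HB.instance Definition _ n :=
  GRing.isZmodMorphism.Build _ _ (@coboundary n) (@coboundaryB n).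
HB.instance Definition _ n :=
  GRing.isZmodMorphism.Build _ _ (@boundary n) (@boundaryB n).

(* the differentials C^{n-1} -> C^n and C_n -> C_{n-1}, where
   C^{-1} = C_{-1} = 0 is encoded by a zero map on C^0, C_0 *)
Definition coboundary_to n : {additive cochain n.-1 A -> cochain n A} :=
  match n with
  | 0 => \0
  | m.+1 => @coboundary m
  end.

Definition boundary_from n : {additive chain n A -> chain n.-1 A} :=
  match n with
  | 0 => \0
  | m.+1 => @boundary m
  end.

Definition group_cohomology n : zmodType :=
  homology (coboundary_to n) (@coboundary n).

Definition group_homology n : zmodType :=
  homology (@boundary n) (boundary_from n).

End Differentials.

Section Functoriality.
Variables (A B : lmodType RG) (f : {linear A -> B}).

Definition group_cohomology_map n :
    group_cohomology A n -> group_cohomology B n :=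
  homology_map _ _ (fun c : cochain n A => f \o c : cochain n B).

Definition group_homology_map n : group_homology A n -> group_homology B n :=
  homology_map _ _
    (fun x : chain n A => malg_ext (fun s a => mkmalgU s (f a)) x : chain n B).

End Functoriality.

Definition zmod0 : zmodType := 'rV[int]_0.

Definition group_cohomologyz (A : lmodType RG) (k : int) : zmodType :=
  match k with Posz n => group_cohomology A n | Negz _ => zmod0 end.

Definition group_homologyz (A : lmodType RG) (k : int) : zmodType :=
  match k with Posz n => group_homology A n | Negz _ => zmod0 end.

Definition group_cohomologyz_map (A B : lmodType RG) (f : {linear A -> B})
    (k : int) : group_cohomologyz A k -> group_cohomologyz B k :=
  match k with
  | Posz n => @group_cohomology_map A B f n
  | Negz _ => id
  end.

Definition group_homologyz_map (A B : lmodType RG) (f : {linear A -> B})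
    (k : int) : group_homologyz A k -> group_homologyz B k :=
  match k with
  | Posz n => @group_homology_map A B f n
  | Negz _ => id
  end.

(* -oo is the supremum of the empty set, which does not occur: H_0(G, R) and
   H^0(G, R) are R, which is not 0. *)
Definition hd : \bar int :=
  supremum -oo%E [set (n%:Z)%:E | n in
    [set n : nat | exists (A : lmodType RG) (x : group_homology A n), x != 0]].

Definition cd : \bar int :=
  supremum -oo%E [set (n%:Z)%:E | n in
    [set n : nat | exists (A : lmodType RG) (x : group_cohomology A n), x != 0]].

(* Naturality with respect to the scalars of the commutative ring R makes the
   additive isomorphisms Phi automatically R-linear. *)
Definition poincare_duality_group : Prop :=
  exists (C : lmodType RG^c) (n : nat),
    (exists e : R -> C,
       [/\ zmod_morphism e, bijective e
         & forall r s, e (r * s) = ract (e s) (gmon r 1%g)]) /\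
    exists Phi : forall (k : int) (A : lmodType RG),
        {additive group_cohomologyz A k ->
                  group_homologyz (tensor_module C A) (n%:Z - k)},
      (forall k A, bijective (Phi k A)) /\
      (forall k (A B : lmodType RG) (f : {linear A -> B}) x,
         Phi k B (group_cohomologyz_map f x) =
         group_homologyz_map (tensor_module_map C f) (Phi k A x)).

End GroupHomology.

Arguments hd : clear implicits.
Arguments cd : clear implicits.
Arguments poincare_duality_group : clear implicits.

Section Finiteness.
Variable S : nzRingType.
Implicit Types P M N : lmodType S.

Definition projective P : Prop :=
  forall M N (p : {linear M -> N}) (f : {linear P -> N}),
    (forall y, exists x, p x = y) ->
    exists h : {linear P -> M}, forall x, p (h x) = f x.

Definition finitely_generated M : Prop :=
  exists s : seq M, forall x, exists c : 'I_(size s) -> S,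
    x = \sum_(i < size s) c i *: s`_i.

Definition projective_resolution M (P : nat -> lmodType S)
    (d : forall i, {linear P i.+1 -> P i}) (eps : {linear P 0 -> M}) : Prop :=
  [/\ forall i, projective (P i),
      forall y, exists x, eps x = y,
      forall x, eps x = 0 <-> exists y, x = d 0 y
    & forall i x, d i x = 0 <-> exists y, x = d i.+1 y].

End Finiteness.

Definition type_FP (R : comNzRingType) (G : groupType) (n : nat) : Prop :=
  exists (P : nat -> lmodType (group_ring R G))
         (d : forall i, {linear P i.+1 -> P i})
         (eps : {linear P 0 -> trivial_module R G}),
    projective_resolution d eps /\
    forall i, (i <= n)%N -> finitely_generated (P i).

Definition type_FP_infty (R : comNzRingType) (G : groupType) : Prop :=
  forall n, type_FP R G n.

(* Main.v *)
Require Import Defs.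
From mathcomp Require Import all_boot all_order all_algebra.
From mathcomp Require Import boolp classical_sets functions cardinality.
From mathcomp Require Import constructive_ereal.
From HB Require Import structures.
From mathcomp Require Import -(notations) monalg.
From mathcomp Require Import finmap.

Set Implicit Arguments.
Unset Strict Implicit.
Unset Printing Implicit Defensive.

Import Order.TTheory GRing.Theory Num.Theory.

Local Open Scope fset_scope.
Local Open Scope classical_set_scope.
Local Open Scope quotient_scope.
Local Open Scope ring_scope.

(* A coarse embedding phi : G -> H identifies the homology of G with
   coefficients in all functions G -> A with the homology of H with coefficients
   in the module of functions H -> A supported in neighbourhoods of phi(G): both
   are computed by the double complex of A-valued functions on pairs of simplices
   of G and H that lie close to each other under phi, whose rows and columns are
   contracted by coning with the vertices psi(y), psi a partial coarse inverse of
   phi, and phi(x). If H_m(G, -) vanishes for m > hd G, then H_(hd G)(G, A) embeds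
   in the homology with coefficients in all functions G -> A. Hence hd G <= n,
   where n is the duality dimension of H; and if hd G = n, then by duality some
   nonzero function supported near phi(G) is invariant up to a character of H,
   so its support is H and phi is coarsely surjective. If moreover G is of type
   FP_infinity, then in each degree k the identity of the bar resolution is
   homotopic to a map of finite rank, that is, a k-chain with coefficients in the
   cochains G^k -> RG; for k > hd G it bounds modulo coboundaries, which makes
   every k-cocycle a coboundary, so that cd G <= hd G. *)

(** * Free and projective modules *)

(** A chain of G with coefficients in all functions G -> A amounts to an A-valued function on the
    simplices of G whose support has finitely many shapes. Such locally finite chains see only the
    coarse structure, so that phi, which need not be a homomorphism, can act on them. Their supports
    are infinite: a differential sums along the fibres of a face map, and each manipulation of these
    sums rests on a proof that the fibres meet the support in finite sets. Closeness under phi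
    yields this whenever the simplex of the other group is nonempty, so the corner of two empty
    simplices has to be avoided. The embedding of A in the functions G -> A is a |-> (x |-> x^-1 a);
    the homology of its cokernel vanishes above hd G, and finiteness of hd G provides a top degree
    at which to use this. The character of H comes from the action on C, which is R as an R-module:
    duality identifies H_n(H, B) with H^0 of B twisted by this character. *)

Lemma homology_eq0P (U V W : zmodType) (f : {additive U -> V})
    (g : {additive V -> W}) :
  (forall x : homology f g, x = 0) <->
  (forall v, g v = 0 -> exists u, v = f u).
Proof.
have val0 : val (0 : kernel g) = 0 by apply: raddf0.
have class0 : homology_class f (0 : kernel g) = 0 by apply: raddf0.
split=> [h0 v v0|hf x].
  have vk : v \in ker_pred g by apply/eqP.
  have /homology_class_eq[u] : homology_class f (Sub v vk : kernel g) =
    homology_class f 0 by rewrite class0; apply: h0.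
  by rewrite val0 subr0 SubK => ->; exists u.
rewrite -(homology_class_repr x) -class0; apply/homology_class_eq.
have /eqP/hf[u xu] := valP (repr x).
by exists u; rewrite val0 subr0.
Qed.

Section FreeModule.
Variables (K : choiceType) (S : nzRingType).
Local Notation free := (malg K S).

Definition basis (k : K) : free := mkmalgU k 1.

Lemma mcoeff_basis k l : mcoeff l (basis k) = (k == l)%:R.
Proof. by rewrite mcoeffU. Qed.

Lemma scale_basis r k : r *: basis k = mkmalgU k r.
Proof.
by apply/malgP => l; rewrite mcoeffZ !mcoeffU mulr_natr.
Qed.

Lemma free_sum (x : free) (X : {fset K}) : (msupp x `<=` X)%fset ->
  x = \sum_(k <- X) mcoeff k x *: basis k.
Proof.
move=> xX; rewrite {1}(monalgEw xX).
by apply: eq_bigr => k _; rewrite scale_basis.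
Qed.

Section Ext.
Variables (A : lmodType S) (c : K -> A).

Definition free_ext (x : free) : A := malg_ext (fun k r => r *: c k) x.

Let hB k : zmod_morphism (fun r => r *: c k).
Proof. by move=> r s; rewrite scalerBl. Qed.

Let free_extB : zmod_morphism free_ext.
Proof. exact: malg_ext_is_zmod_morphism hB. Qed.

Let free_extU k r : free_ext (mkmalgU k r) = r *: c k.
Proof. exact: malg_extU hB k r. Qed.

Let free_extZ r : {morph free_ext : x / r *: x}.
Proof.
apply: malg_morphism_eq => [x y|x y|k s].
- by rewrite scalerBr free_extB.
- by rewrite free_extB scalerBr.
by rewrite -scale_basis scalerA !scale_basis !free_extU scalerA.
Qed.

HB.instance Definition _ :=
  GRing.isZmodMorphism.Build free A free_ext free_extB.
HB.instance Definition _ :=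
  GRing.isScalable.Build S free A *:%R free_ext free_extZ.

Lemma free_ext_basis k : free_ext (basis k) = c k.
Proof. by rewrite free_extU scale1r. Qed.

End Ext.

Lemma linear_free_eq (A : lmodType S) (f g : {linear free -> A}) :
  (forall k, f (basis k) = g (basis k)) -> f =1 g.
Proof.
move=> fg; apply: malg_morphism_eq => [||k r]; try exact: raddfB.
by rewrite -scale_basis !linearZ fg.
Qed.

Lemma free_projective : projective free.
Proof.
move=> M N p f pS; have /choice[c cE] k : exists x, p x = f (basis k).
  exact: pS.
exists (free_ext c : {linear _ -> _}); apply: (linear_free_eq
  (f := p \o free_ext c)) => k /=.
by rewrite free_ext_basis.
Qed.

End FreeModule.

(** [v] need not be onto; it only has to reach the image of [u]. [P] is a retract of the free module
    on its own elements, where the lift is chosen on the basis. *)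
Lemma projective_lift (S : nzRingType) (P M N : lmodType S)
    (u : {linear P -> N}) (v : {linear M -> N}) :
  projective P -> (forall x, exists y, u x = v y) ->
  exists w : {linear P -> M}, forall x, v (w x) = u x.
Proof.
move=> projP uv; have /choice[c cE] x := uv x.
have [y|h hE] := projP _ _ (free_ext (fun x : P => x)) idfun.
  by exists (basis S y); apply: (free_ext_basis (fun x : P => x)).
exists (free_ext c \o h : {linear P -> M}) => x /=.
have vc : v \o free_ext c =1 u \o free_ext (fun x : P => x).
  apply: (linear_free_eq (f := v \o free_ext c)) => k /=.
  by rewrite !free_ext_basis.
by rewrite [v _](vc (h x)) /= hE.
Qed.

(** * The bar resolution *)

Section Faces.
Variable G : groupType.
Implicit Types (n i : nat) (g : G).

Lemma face0_cons n g (s : n.-tuple G) : face 0 [tuple of g :: s] = s.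
Proof.
apply: eq_from_tnth => j; rewrite tnth_mktuple /= (tnth_nth 1%g) //.
Qed.

Lemma face1_cons n g (s : n.+1.-tuple G) :
  face 1 [tuple of g :: s] = [tuple of (g * thead s)%g :: face 0 s].
Proof.
apply: eq_from_tnth => j; rewrite tnth_mktuple (tnth_nth 1%g) /=.
case: (unliftP ord0 j) => [k|] -> /=; last first.
  by rewrite /thead (tnth_nth 1%g).
by rewrite add0n -[RHS](tnth_nth _ (face 0 s)) tnth_mktuple.
Qed.

Lemma faceSS_cons n i g (s : n.+1.-tuple G) :
  face i.+2 [tuple of g :: s] = [tuple of g :: face i.+1 s].
Proof.
apply: eq_from_tnth => j; rewrite tnth_mktuple (tnth_nth 1%g) /=.
case: (unliftP ord0 j) => [k|] -> //=.
by rewrite add0n -[RHS](tnth_nth _ (face i.+1 s)) tnth_mktuple.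
Qed.

End Faces.

Lemma scaler_signC (S : nzRingType) (V : lmodType S) (a : S) n (x : V) :
  a *: ((-1) ^+ n *: x) = (-1) ^+ n *: (a *: x).
Proof. by rewrite !scalerA commr_sign. Qed.

Section BarResolution.
Variables (R : comNzRingType) (G : groupType).
Local Notation RG := (group_ring R G).

Definition bar n : lmodType RG := malg (n.-tuple G) RG.
Definition bar_basis n (s : n.-tuple G) : bar n := basis RG s.

Definition cochain_ext n (A : lmodType RG) (c : cochain n A) :
  {linear bar n -> A} := free_ext c : {linear _ -> _}.

Lemma cochain_extE n (A : lmodType RG) (c : cochain n A) s :
  cochain_ext c (bar_basis s) = c s.
Proof. exact: free_ext_basis. Qed.

Lemma linear_bar_eq n (A : lmodType RG) (f g : {linear bar n -> A}) :
  (forall s, f (bar_basis s) = g (bar_basis s)) -> f =1 g.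
Proof. exact: linear_free_eq. Qed.

(** The boundary of [s] is the coboundary of the universal cochain [bar_basis], evaluated at s.
    Hence precomposition with [bar_diff] is [coboundary] for every module. *)
Definition bar_diff n : {linear bar n.+1 -> bar n} :=
  cochain_ext (coboundary (@bar_basis n)).

Lemma cochain_ext_diff n (A : lmodType RG) (c : cochain n A) x :
  cochain_ext c (bar_diff n x) = cochain_ext (coboundary c) x.
Proof.
move: x; apply: (linear_bar_eq (f := cochain_ext c \o bar_diff n)) => s /=.
rewrite !cochain_extE linear_sum; apply: eq_bigr => i _.
rewrite linearZ_LR; congr (_ *: _).
by case: ifP => _; rewrite ?linearZ cochain_extE.
Qed.

Lemma coboundaryE n (A : lmodType RG) (c : cochain n A) s :
  coboundary c s = cochain_ext c (bar_diff n (bar_basis s)).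
Proof. by rewrite cochain_ext_diff cochain_extE. Qed.

Definition bar_aug : {linear bar 0 -> trivial_module R G} :=
  cochain_ext (fun=> 1 : trivial_module R G).

(** The contraction g[s] |-> [g, s] of the augmented bar complex, additive but not RG-linear: the
    scalar r stays a coefficient while g enters the tuple. *)
Definition bar_cone n : bar n -> bar n.+1 :=
  malg_ext (fun (s : n.-tuple G) => malg_ext (fun (g : G) (r : R) =>
    mkmalgU [tuple of g :: s] (gmon r 1%g : RG))).

Let coneUB n (s : n.-tuple G) g :
  zmod_morphism (fun r : R => mkmalgU [tuple of g :: s] (gmon r 1%g : RG)).
Proof. by move=> q r; rewrite gmonB monalgUB. Qed.

Lemma bar_coneB n : zmod_morphism (@bar_cone n).
Proof.
apply: malg_ext_is_zmod_morphism => s.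
exact: (malg_ext_is_zmod_morphism (coneUB s)).
Qed.

HB.instance Definition _ n :=
  GRing.isZmodMorphism.Build _ _ (@bar_cone n) (@bar_coneB n).

Lemma bar_coneE n r g (s : n.-tuple G) :
  bar_cone (gmon r g *: bar_basis s) =
  gmon r 1%g *: bar_basis [tuple of g :: s].
Proof.
rewrite [_ *: _]scale_basis [RHS]scale_basis.
rewrite /bar_cone malg_extU ?[LHS](malg_extU (coneUB s)) // => t.
exact: (malg_ext_is_zmod_morphism (coneUB t)).
Qed.

Lemma bar_morphism_eq n (B : zmodType) (f g : bar n -> B) :
  zmod_morphism f -> zmod_morphism g ->
  (forall r h s, f (gmon r h *: bar_basis s) = g (gmon r h *: bar_basis s)) ->
  f =1 g.
Proof.
move=> fB gB fg; apply: malg_morphism_eq => // s.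
apply: (@group_ring_morphism_eq R G B (fun a => f (mkmalgU s a))
  (fun a => g (mkmalgU s a))) => [x y|x y|r h].
- by rewrite monalgUB fB.
- by rewrite monalgUB gB.
by rewrite -[mkmalgU _ _]scale_basis fg.
Qed.

Lemma bar_diffE n (s : n.+1.-tuple G) :
  bar_diff n (bar_basis s) = gmon 1 (thead s) *: bar_basis (face 0 s) +
    \sum_(i < n.+1) (-1) ^+ i.+1 *: bar_basis (face i.+1 s).
Proof.
rewrite /bar_diff cochain_extE /coboundary big_ord_recl.
by rewrite [X in X *: _]expr0 scale1r.
Qed.

Lemma bar_diff_cone n r g (s : n.-tuple G) :
  bar_diff n (bar_cone (gmon r g *: bar_basis s)) = gmon r g *: bar_basis s -
    \sum_(i < n.+1) (-1) ^+ i *: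
      (gmon r 1%g *: bar_basis (face i.+1 [tuple of g :: s])).
Proof.
rewrite bar_coneE linearZ_LR bar_diffE scalerDr scalerA gmonM mulr1 mul1g.
rewrite face0_cons -sumrN scaler_sumr; congr (_ *: _ + _).
apply: eq_bigr => i _.
by rewrite scaler_signC exprS mulN1r scaleNr.
Qed.

Lemma bar_contraction n x :
  bar_diff n.+1 (bar_cone x) + bar_cone (bar_diff n x) = x.
Proof.
move: x; apply: bar_morphism_eq => [x y|//|r g s].
  by rewrite !raddfB /= addrACA -opprD.
rewrite bar_diff_cone -addrA; apply: (addrI (- (gmon r g *: bar_basis s))).
rewrite addKr addNr addrC; apply/eqP; rewrite subr_eq0; apply/eqP.
rewrite [bar_diff n _]linearZ_LR bar_diffE scalerDr scalerA gmonM mulr1.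
rewrite (zmod_morphismD (@bar_coneB _)).
rewrite [RHS]big_ord_recl expr0 scale1r; congr (_ + _).
  by rewrite face1_cons bar_coneE.
rewrite scaler_sumr raddf_sum; apply: eq_bigr => i _ /=.
by rewrite faceSS_cons scaler_signC raddfZsign /= bar_coneE.
Qed.

Lemma bar_augE r g s : bar_aug (gmon r g *: bar_basis s) = r.
Proof. by rewrite linearZ_LR cochain_extE action_moduleE; apply: mulr1. Qed.

Lemma bar_contraction0 x :
  bar_diff 0 (bar_cone x) + gmon (bar_aug x) 1%g *: bar_basis [tuple] = x.
Proof.
move: x; apply: bar_morphism_eq => [x y|//|r g s].
  by rewrite !raddfB /= gmonB scalerBl addrACA -opprD.
rewrite bar_diff_cone big_ord1 expr0 scale1r (tuple0 s) (tuple0 (face _ _)).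
by rewrite bar_augE subrK.
Qed.

Lemma bar_exact n x : bar_diff n x = 0 -> x = bar_diff n.+1 (bar_cone x).
Proof. by move=> x0; rewrite -[LHS]bar_contraction x0 raddf0 addr0. Qed.

Lemma bar_exact0 x : bar_aug x = 0 -> x = bar_diff 0 (bar_cone x).
Proof.
move=> x0; rewrite -[LHS]bar_contraction0 x0.
by rewrite [gmon _ _]monalgU0 scale0r addr0.
Qed.

Lemma bar_aug_surj y : exists x, bar_aug x = y.
Proof.
exists (gmon (y : R) 1%g *: bar_basis [tuple]).
exact: bar_augE.
Qed.

(** [g, s] is the cone of g[s], so the cones generate [bar n.+1] as a module. *)
Lemma linear_bar_cone_eq n (A : lmodType RG) (f g : {linear bar n.+1 -> A}) :
  (forall x, f (bar_cone x) = g (bar_cone x)) -> f =1 g.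
Proof.
move=> fg; apply: linear_bar_eq => s.
suff -> : bar_basis s = bar_cone (gmon 1 (thead s) *: bar_basis (face 0 s)).
  exact: fg.
rewrite bar_coneE gmon11 scale1r; congr (bar_basis _).
by rewrite [s in face 0 s]tuple_eta face0_cons -tuple_eta.
Qed.

Lemma bar_augK x : bar_aug (bar_diff 0 x) = 0.
Proof.
move: x; apply: (linear_bar_eq (f := bar_aug \o bar_diff 0) (g := \0)) => s /=.
rewrite bar_diffE big_ord1 raddfD /= expr1 scaleN1r raddfN /= bar_augE.
by rewrite /bar_aug cochain_extE subrr.
Qed.

(** With the contraction h, d d h = d (1 - h d) = d - (1 - h d) d = h d d, which is 0 by induction,
    and cones generate. In the lowest degree the augmentation replaces the lower differential. *)
Lemma bar_diffK n x : bar_diff n (bar_diff n.+1 x) = 0.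
Proof.
elim: n x => [|n IHn] x; move: x.
  apply: (linear_bar_cone_eq (f := bar_diff 0 \o bar_diff 1) (g := \0)) => x /=.
  have /(canRL (addrK _)) -> := bar_contraction x.
  rewrite raddfB /=; have /(canRL (addrK _)) -> := bar_contraction0 (bar_diff 0 x).
  rewrite opprB addrC subrK.
  by rewrite bar_augK [gmon _ _]monalgU0 scale0r.
apply: (linear_bar_cone_eq (f := bar_diff n.+1 \o bar_diff n.+2) (g := \0)) => x /=.
have /(canRL (addrK _)) -> := bar_contraction x.
rewrite raddfB /=.
have /(canRL (addrK _)) -> := bar_contraction (bar_diff n.+1 x).
by rewrite IHn raddf0 subr0 subrr.
Qed.

End BarResolution.

(** * Chains and coefficient sequences *)

Lemma scale_sign (S : nzRingType) (V : lmodType S) n (x : V) :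
  (-1) ^+ n *: x = if odd n then - x else x.
Proof. by rewrite -signr_odd; case: (odd n); rewrite ?scaleN1r ?scale1r. Qed.

Section ChainMaps.
Variables (R : comNzRingType) (G : groupType).
Local Notation RG := (group_ring R G).

Lemma boundaryU n (A : lmodType RG) (s : n.+1.-tuple G) (a : A) :
  boundary (mkmalgU s a : chain n.+1 A) =
  mkmalgU (face 0 s) (gmon 1 (thead s)^-1%g *: a) +
    \sum_(i < n.+1) mkmalgU (face i.+1 s) ((-1) ^+ i.+1 *: a).
Proof.
rewrite /boundary malg_extU ?big_ord_recl ?expr0 ?scale1r // => t b b'.
rewrite -sumrB; apply: eq_bigr => i _; rewrite -monalgUB -scalerBr.
by congr (mkmalgU _ (_ *: _)); case: ifP => // _; rewrite -scalerBr.
Qed.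

Section BarChain.
Variables (A : lmodType RG) (a : A).

(* x |-> a (x) x, for the right module structure a g = g^-1 a *)
Definition bar_chain n : bar R G n -> chain n A :=
  malg_ext (fun s : n.-tuple G => malg_ext (fun (g : G) (r : R) =>
    mkmalgU s (gmon r g^-1%g *: a))).

Let chainUB n (s : n.-tuple G) (g : G) :
  zmod_morphism (fun r : R => mkmalgU s (gmon r g^-1%g *: a)).
Proof. by move=> q r; rewrite gmonB scalerBl monalgUB. Qed.

Lemma bar_chainB n : zmod_morphism (@bar_chain n).
Proof.
apply: malg_ext_is_zmod_morphism => s.
exact: (malg_ext_is_zmod_morphism (chainUB s)).
Qed.

HB.instance Definition _ n :=
  GRing.isZmodMorphism.Build _ _ (@bar_chain n) (@bar_chainB n).

Lemma bar_chainE n r g (s : n.-tuple G) :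
  bar_chain (gmon r g *: bar_basis R s) = mkmalgU s (gmon r g^-1%g *: a).
Proof.
rewrite [_ *: _]scale_basis.
rewrite /bar_chain malg_extU ?[LHS](malg_extU (chainUB s)) // => t.
exact: (malg_ext_is_zmod_morphism (chainUB t)).
Qed.

Lemma boundary_bar_chain n x :
  boundary (@bar_chain n.+1 x) = bar_chain (bar_diff R G n x).
Proof.
move: x; apply: bar_morphism_eq => [x y|x y|r g s]; rewrite ?raddfB //.
rewrite [bar_diff _ _ _ _]linearZ_LR bar_diffE scalerDr scalerA gmonM mulr1.
rewrite bar_chainE boundaryU raddfD /=; congr (_ + _).
  by rewrite bar_chainE scalerA gmonM mul1r invgM.
rewrite scaler_sumr raddf_sum; apply: eq_bigr => i _ /=.
rewrite scaler_signC !scale_sign.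
by case: (odd _); rewrite ?raddfN /= bar_chainE // monalgUN.
Qed.

End BarChain.

(** A generator [mkmalgU s a] is the image of [s] under [bar_chain a], which commutes with the
    differentials. *)
Lemma boundaryK n (A : lmodType RG) (x : chain n.+2 A) :
  boundary (boundary x) = 0.
Proof.
move: x; apply: (malg_morphism_eq (g := \0)) => [x y|x y|s a].
- by rewrite !raddfB.
- by rewrite subrr.
have <- : bar_chain a (gmon 1 1%g *: bar_basis R s) = mkmalgU s a.
  by rewrite bar_chainE invg1 scale1r.
by rewrite !boundary_bar_chain bar_diffK raddf0.
Qed.

Section Coefficients.
Variables (A B : lmodType RG) (f : {linear A -> B}).

Definition chain_map n (x : chain n A) : chain n B :=
  malg_ext (fun (s : n.-tuple G) a => mkmalgU s (f a)) x.

Let fB n (s : n.-tuple G) : zmod_morphism (fun a => mkmalgU s (f a)).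
Proof. by move=> a b; rewrite raddfB monalgUB. Qed.

Lemma chain_mapB n : zmod_morphism (@chain_map n).
Proof. exact: malg_ext_is_zmod_morphism (@fB n). Qed.

HB.instance Definition _ n :=
  GRing.isZmodMorphism.Build _ _ (@chain_map n) (@chain_mapB n).

Lemma chain_mapU n (s : n.-tuple G) a :
  chain_map (mkmalgU s a) = mkmalgU s (f a).
Proof. exact: (malg_extU (@fB n)). Qed.

Lemma mcoeff_chain_map n (s : n.-tuple G) (x : chain n A) :
  mcoeff s (chain_map x) = f (mcoeff s x).
Proof.
move: x; apply: malg_morphism_eq => [x y|x y|t a]; rewrite ?raddfB //=.
by rewrite chain_mapU !mcoeffU raddfMn.
Qed.

Lemma boundary_chain_map n (x : chain n.+1 A) :
  boundary (chain_map x) = chain_map (boundary x).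
Proof.
move: x; apply: malg_morphism_eq => [x y|x y|s a]; rewrite ?raddfB //.
rewrite chain_mapU !boundaryU raddfD raddf_sum /=; congr (_ + _).
  by rewrite chain_mapU linearZ_LR.
by apply: eq_bigr => i _; rewrite chain_mapU raddfZsign.
Qed.

Lemma chain_map_inj n : injective f -> injective (@chain_map n).
Proof.
move=> f_inj x y xy; apply/malgP => s; apply: f_inj.
by rewrite -!mcoeff_chain_map xy.
Qed.

Lemma chain_map_lift n (y : chain n B) :
  (forall s, exists a, f a = mcoeff s y) -> exists x, chain_map x = y.
Proof.
move=> /choice[g gE]; exists (\sum_(s <- msupp y) mkmalgU s (g s)).
rewrite raddf_sum [RHS]monalgE; apply: eq_bigr => s _ /=.
by rewrite chain_mapU gE.
Qed.

End Coefficients.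

(** Vanishing of [group_homology A n] on the level of cycles; as [boundary_from A 0] is zero, every
    0-chain counts as a cycle. *)
Definition homology_vanish (A : lmodType RG) n : Prop :=
  forall x, boundary_from A n x = 0 -> exists y, x = @boundary _ _ A n y.

Lemma homology_vanishP A n :
  homology_vanish A n <-> forall x : group_homology A n, x = 0.
Proof. by rewrite homology_eq0P. Qed.

Lemma homology_vanish_bij (A B : lmodType RG) (f : {linear A -> B}) n :
  bijective f -> homology_vanish B n -> homology_vanish A n.
Proof.
move=> bij_f HB x x0.
have [|y yE] := HB (chain_map f x).
  case: n x x0 {HB} => [//|n] x /= x0.
  by rewrite boundary_chain_map x0 raddf0.
have [z zE] : exists z, chain_map f z = y.
  apply: chain_map_lift => s; have [g _ fK] := bij_f.
  by exists (g (mcoeff s y)).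
exists z; apply: (chain_map_inj (bij_inj bij_f)).
by rewrite -boundary_chain_map zE.
Qed.
End ChainMaps.

Lemma quotient_lmodule (S : nzRingType) (V : lmodType S) (K : V -> Prop) :
  K 0 -> (forall a x y, K x -> K y -> K (a *: x + y)) ->
  exists (W : lmodType S) (p : {linear V -> W}),
    (forall w, exists v, p v = w) /\ (forall v, p v = 0 <-> K v).
Proof.
move=> K0 KD; pose Kp : {pred V} := fun x => `[< K x >].
have KB : zmod_closed Kp.
  split=> [|x y /asboolP Kx /asboolP Ky]; apply/asboolP => //.
  by rewrite addrC -scaleN1r; apply: KD.
pose Kz : zmodClosed V := HB.pack Kp (GRing.isZmodClosed.Build _ Kp KB).
pose Q : zmodType := Quotient.quot Kz; pose pi v : Q := \pi_(Quotient.quot Kz) v.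
have piB : zmod_morphism pi by exact: (raddfB \pi_(Quotient.quot Kz)).
have pi_eq u v : pi u = pi v <-> K (u - v).
  split=> [/eqP|uv]; last apply/eqP; rewrite /pi eqmodE /=; first by move/asboolP.
  exact/asboolP.
have piK x : pi (repr x) = x by apply: reprK.
have KZ a x : K x -> K (a *: x) by move=> Kx; rewrite -[_ *: _]addr0; apply: KD.
pose sc (a : S) (x : Q) := pi (a *: repr x).
have scE a v : sc a (pi v) = pi (a *: v).
  by apply/pi_eq; rewrite -scalerBr; apply/KZ/pi_eq/piK.
have scA a b x : sc a (sc b x) = sc (a * b) x.
  by rewrite -[x]piK !scE scalerA.
have sc1 : left_id 1 sc by move=> x; rewrite -[x]piK scE scale1r.
have piD := zmod_morphismD piB.
have scDr : right_distributive sc +%R.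
  by move=> a x y; rewrite -[x]piK -[y]piK -piD !scE scalerDr piD.
have scDl x : {morph sc^~ x : a b / a + b}.
  by move=> a b; rewrite -[x]piK !scE scalerDl piD.
pose W : lmodType S := HB.pack (Quotient.quot Kz)
  (GRing.Zmodule_isLmodule.Build S (Quotient.quot Kz) scA sc1 scDr scDl).
pose p : {linear V -> W} := HB.pack (pi : V -> W)
  (GRing.isZmodMorphism.Build V W pi piB)
  (GRing.isScalable.Build S V W *:%R pi (fun a v => esym (scE a v))).
exists W, p; split=> [w|v]; first by exists (repr w); apply: piK.
have -> : (p v = 0) = (pi v = pi 0) by rewrite [pi 0](raddf0 p).
by rewrite pi_eq subr0.
Qed.

(** * Dimension shifting in the top degree *)

Section TopDegree.
Variables (R : comNzRingType) (G : groupType).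
Local Notation RG := (group_ring R G).

(** The segment H_{n+1}(B/A) -> H_n(A) -> H_n(B) of the long exact sequence, chased on chains. *)
Lemma homology_vanish_sub (A B : lmodType RG) (i : {linear A -> B}) n :
  injective i -> (forall W : lmodType RG, homology_vanish W n.+1) ->
  homology_vanish B n -> homology_vanish A n.
Proof.
move=> i_inj HW HB v v0.
have [||W [p [pS pE]]] := @quotient_lmodule _ B (fun b => exists a, b = i a).
- by exists 0; rewrite raddf0.
- by move=> c _ _ [a ->] [b ->]; exists (c *: a + b); rewrite linearP.
have [|w wE] := HB (chain_map i v).
  case: n v v0 {HW HB} => [//|n] v /= v0.
  by rewrite boundary_chain_map v0 raddf0.
(* [w] bounds the image of [v], so it is a cycle modulo A and bounds there; subtracting the boundary
   of a lift moves [w] into A. *)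
have [|u' u'E] := HW W (chain_map p w).
  rewrite /= boundary_chain_map -wE; apply/malgP => s.
  by rewrite !mcoeff_chain_map mcoeff0; apply/pE; exists (mcoeff s v).
have [u uE] : exists u, chain_map p u = u' by apply: chain_map_lift.
have [t tE] : exists t, chain_map i t = w - boundary u.
  apply: chain_map_lift => s; have /pE[a ->] : p (mcoeff s (w - boundary u)) = 0.
    by rewrite -mcoeff_chain_map raddfB /= -boundary_chain_map uE u'E subrr mcoeff0.
  by exists a.
exists t; apply: (chain_map_inj i_inj).
by rewrite -boundary_chain_map tE raddfB /= boundaryK subr0.
Qed.

End TopDegree.

(** * Cohomology of groups of type FP *)

Section Comparison.
Variables (R : comNzRingType) (G : groupType).
Local Notation RG := (group_ring R G).
Local Notation bar := (bar R G).
Local Notation bar_diff := (bar_diff R G).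
Variables (P : nat -> lmodType RG) (d : forall i, {linear P i.+1 -> P i}).
Variable eps : {linear P 0 -> trivial_module R G}.
Hypothesis resP : projective_resolution d eps.

(** The invariant of the induction, imposed on boundaries only: there the term h' d of the homotopy
    formula d h + h' d = 1 - g f drops out, so no data of degree k - 1 occur. *)
Definition comparison k (f : {linear bar k -> P k}) (g : {linear P k -> bar k})
    (h : {linear bar k -> bar k.+1}) : Prop :=
  [/\ forall x, exists y, f (bar_diff k x) = d k y,
      forall x, exists y, g (d k x) = bar_diff k y
    & forall x, bar_diff k (h (bar_diff k x)) =
                bar_diff k x - g (f (bar_diff k x))].

Lemma comparison0 : exists f g h, @comparison 0 f g h.
Proof.
have [projP epsS eps0 _] := resP.
have barP : projective (bar 0) by apply: free_projective.
have [x|f fE] := projective_lift (v := eps) (u := bar_aug R G) barP.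
  by have [y <-] := epsS (bar_aug R G x); exists y.
have [x|g gE] := projective_lift (v := bar_aug R G) (u := eps) (projP 0).
  by have [y <-] := bar_aug_surj (eps x); exists y.
have [x|h hE] := projective_lift (u := idfun \- (g \o f)) (v := bar_diff 0) barP.
  exists (bar_cone (x - g (f x))); apply: bar_exact0.
  by rewrite raddfB /= gE fE subrr.
exists f, g, h; split=> [x|x|x]; last by rewrite hE.
  by apply/eps0; rewrite fE bar_augK.
exists (bar_cone (g (d 0 x))); apply: bar_exact0.
by rewrite gE; apply/eps0; exists x.
Qed.

Lemma comparison_succ k f g h : @comparison k f g h ->
  exists f' g' h', @comparison k.+1 f' g' h' /\
    forall x, bar_diff k.+1 (h' x) + h (bar_diff k x) = x - g' (f' x).
Proof.
have [projP _ _ exP] := resP; move=> [fd gd hd].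
have barP : projective (bar k.+1) by apply: free_projective.
have [//|f' f'E] := projective_lift (u := f \o bar_diff k) (v := d k) barP.
have [//|g' g'E] := projective_lift (u := g \o d k) (v := bar_diff k) (projP k.+1).
have [x|h' h'E] := projective_lift
    (u := idfun \- (g' \o f') \- (h \o bar_diff k)) (v := bar_diff k.+1) barP.
  exists (bar_cone (x - g' (f' x) - h (bar_diff k x))); apply: bar_exact.
  by rewrite !raddfB /= hd g'E /= f'E /= subrr.
have h'E' x : bar_diff k.+1 (h' x) + h (bar_diff k x) = x - g' (f' x).
  by rewrite h'E /= subrK.
exists f', g', h'; split=> //; split=> x.
- by apply/exP; rewrite f'E /= bar_diffK raddf0.
- exists (bar_cone (g' (d k.+1 x))); apply: bar_exact; rewrite g'E /=.
  by rewrite (_ : d k _ = 0) ?raddf0 //; apply/exP; exists x.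
by rewrite -h'E' bar_diffK raddf0 addr0.
Qed.

(** The map [g \o f] factors through [P k.+1]; this is how finite generation of [P k.+1] turns into
    finite rank. *)
Lemma comparison_homotopy k :
  exists (f : {linear bar k.+1 -> P k.+1}) (g : {linear P k.+1 -> bar k.+1})
    (h : {linear bar k.+1 -> bar k.+2}) (h' : {linear bar k -> bar k.+1}),
    forall x, bar_diff k.+1 (h x) + h' (bar_diff k x) = x - g (f x).
Proof.
have [f [g [h /comparison_succ[f' [g' [h' [_ hE]]]]]]] :
    exists f g h, @comparison k f g h.
  elim: k => [|k [f [g [h /comparison_succ[f' [g' [h' [cmp _]]]]]]]].
    exact: comparison0.
  by exists f', g', h'.
by exists f', g', h', h.
Qed.

End Comparison.

(** * Maps of finite rank as chains with coefficients in cochains *)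

Section FiniteRank.
Variables (R : comNzRingType) (G : groupType).
Local Notation RG := (group_ring R G).
Local Notation bar := (bar R G).
Local Notation bar_diff := (bar_diff R G).

Lemma coboundaryZr n (A : lmodType RG) (t : cochain n (RG^o)) (a : A) s :
  coboundary (fun u => (t u : RG) *: a) s = (coboundary t s : RG) *: a.
Proof.
rewrite /coboundary scaler_suml; apply: eq_bigr => i _.
by case: ifP => _; rewrite -!scalerA.
Qed.

Lemma cochain_sumE n (A : lmodType RG) (I : Type) (r : seq I)
    (F : I -> cochain n A) t :
  (\sum_(i <- r) F i) t = \sum_(i <- r) F i t.
Proof. by apply: (big_morph (fun f : cochain n A => f t)). Qed.

Lemma coboundary_linear n (A : lmodType RG) (f : {linear bar n -> A}) s :
  coboundary (fun u => f (bar_basis R u)) s = f (bar_diff n (bar_basis R s)).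
Proof.
rewrite coboundaryE; move: (bar_diff n _).
by apply: linear_bar_eq => t; rewrite cochain_extE.
Qed.

(* the left module structure on maps to RG that commutes with the left module
   structure of RG *)
Section CochainModule.
Variable k : nat.
Local Notation V := (cochain k (RG^o)).

Let act (r : R) (g : G) (t : V) : V := fun s => (t s : RG) * gmon r g^-1%g.

Let actBl g t : zmod_morphism (fun r => act r g t).
Proof. by move=> q r; apply/funext => s; rewrite /act gmonB mulrBr. Qed.

Let actBr r g : zmod_morphism (act r g).
Proof. by move=> t u; apply/funext => s; rewrite /act mulrBl. Qed.

Let act11 t : act 1 1%g t = t.
Proof. by apply/funext => s; rewrite /act invg1 gmon11 mulr1. Qed.

Let actM q r g h t : act q g (act r h t) = act (q * r) (g * h)%g t.
Proof.
by apply/funext => s; rewrite /act -mulrA gmonM invgM mulrC.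
Qed.

Definition cochain_action : monomial_action R G V :=
  MonomialAction actBl actBr act11 actM.

Definition cochain_module : lmodType RG := action_module cochain_action.

Lemma cochain_moduleE r g (t : cochain_module) (s : k.-tuple G) :
  (gmon r g *: t : V) s = ((t : V) s : RG) * gmon r g^-1%g.
Proof. by rewrite [_ *: _](action_moduleE r g t). Qed.

Section Eval.
Variables (m : nat) (t : k.-tuple G).

(** A chain [b] stands for the map [t] |-> sum over s of b_s(t) [s] of finite rank; this is its
    value at [t]. *)
Definition chain_eval (b : chain m cochain_module) : bar m :=
  malg_ext (fun (s : m.-tuple G) (u : cochain_module) =>
    mkmalgU s ((u : V) t : RG)) b.

Let evalUB (s : m.-tuple G) :
  zmod_morphism (fun u : cochain_module => mkmalgU s ((u : V) t : RG)).
Proof. by move=> u v; rewrite -monalgUB. Qed.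

Lemma chain_evalB : zmod_morphism chain_eval.
Proof. exact: malg_ext_is_zmod_morphism evalUB. Qed.

HB.instance Definition _ :=
  GRing.isZmodMorphism.Build _ _ chain_eval chain_evalB.

Lemma chain_evalU s (u : cochain_module) :
  chain_eval (mkmalgU s u) = ((u : V) t : RG) *: bar_basis R s.
Proof. by rewrite [RHS]scale_basis; apply: (malg_extU evalUB). Qed.

Lemma mcoeff_chain_eval s b :
  mcoeff s (chain_eval b) = (mcoeff s b : V) t.
Proof.
move: b; apply: malg_morphism_eq => [x y|x y|u v]; rewrite ?raddfB //=.
rewrite chain_evalU [_ *: _]scale_basis !mcoeffU; by case: (u == s).
Qed.

End Eval.

(** The inverse in the action on [cochain_module] cancels the inverse in [boundary]: b_s(t) gets
    multiplied on the right by the first entry of s, as in d[s]. So [boundary] is composition with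
    [bar_diff]. *)
Lemma chain_eval_boundary m t (b : chain m.+1 cochain_module) :
  chain_eval t (boundary b) = bar_diff m (chain_eval t b).
Proof.
move: b; apply: malg_morphism_eq => [x y|x y|s u]; rewrite ?raddfB //.
rewrite boundaryU chain_evalU linearZ_LR bar_diffE raddfD scalerDr.
apply: (f_equal2 (@GRing.add (bar m))) => /=.
  rewrite chain_evalU scalerA; apply: (f_equal2 *:%R _ erefl).
  by rewrite cochain_moduleE invgK.
rewrite raddf_sum scaler_sumr; apply: eq_bigr => i _.
rewrite /= chain_evalU scaler_signC !scale_sign.
by case: (odd _) => //; rewrite -scaleNr.
Qed.

End CochainModule.

(** Right multiplication of the values commutes with [coboundary], whose image is therefore a
    submodule and has a cokernel. *)
Lemma coboundaryZ k (a : RG) (t : cochain k (RG^o)) :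
  a *: (coboundary t : cochain_module k.+1) =
  coboundary ((a *: (t : cochain_module k)) : cochain k (RG^o))
    :> cochain k.+1 (RG^o).
Proof.
move: a; apply: group_ring_morphism_eq => [a b|a b|r g].
- by rewrite scalerBl.
- by rewrite scalerBl [LHS]raddfB.
apply/funext => s; rewrite [LHS]cochain_moduleE.
rewrite [RHS](_ : _ = coboundary (fun u => (t u : RG) *: (gmon r g^-1%g : RG^o)) s).
  by rewrite coboundaryZr.
by congr (coboundary _ s); apply/funext => u; rewrite cochain_moduleE.
Qed.

Definition bar_coef m (s : m.-tuple G) : {linear bar m -> RG^o} :=
  cochain_ext (fun t => (t == s)%:R : RG^o).

Lemma bar_coefE m (s : m.-tuple G) x : bar_coef s x = mcoeff s x.
Proof.
move: x; apply: malg_morphism_eq => [x y|x y|t a]; rewrite ?raddfB //=.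
rewrite -[mkmalgU t a]scale_basis linearZ_LR [X in _ *: X]cochain_extE.
by rewrite [LHS]mulr_natr mcoeffZ mcoeff_basis mulr_natr.
Qed.

(* A map N of finite rank on bar k.+1 is a k.+1-chain with coefficients in
   cochain_module k.+1. If N is homotopic to the identity, then this chain becomes
   a cycle over the cokernel W of the coboundary into cochain_module k.+1; lifting
   a chain that it bounds gives N = d N' + S d, and cocycles kill d. *)
Lemma cohomology_vanish_finite_rank k (N : {linear bar k.+1 -> bar k.+1})
    (h : {linear bar k.+1 -> bar k.+2}) (h' : {linear bar k -> bar k.+1})
    (D : {fset k.+1.-tuple G}) :
  (forall x, bar_diff k.+1 (h x) + h' (bar_diff k x) = x - N x) ->
  (forall x, (msupp (N x) `<=` D)%fset) ->
  (forall W : lmodType RG, homology_vanish W k.+1) ->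
  forall (A : lmodType RG) (c : cochain k.+1 A), coboundary c = 0 ->
  exists c', c = coboundary c'.
Proof.
move=> hE ND HW A c c0.
have NE z : N z = z - (bar_diff k.+1 (h z) + h' (bar_diff k z)).
  by rewrite hE subKr.
pose V := cochain_module k.+1.
have [||W [p [pS pE]]] := @quotient_lmodule _ V
    (fun t => exists u : cochain k (RG^o), t = coboundary u).
- by exists 0; rewrite raddf0.
- move=> a _ _ [t ->] [u ->]; rewrite coboundaryZ.
  exists ((a *: (t : cochain_module k)) + u : cochain k (RG^o)).
  by rewrite raddfD.
pose x : chain k.+1 V := \sum_(s <- D)
  mkmalgU s ((fun t => mcoeff s (N (bar_basis R t))) : V).
have xE t : chain_eval t x = N (bar_basis R t).
  rewrite raddf_sum [RHS](free_sum (ND _)); apply: eq_bigr => s _ /=.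
  by rewrite chain_evalU.
have [|u uE] := HW W (chain_map p x).
  rewrite /= boundary_chain_map; apply/malgP => s.
  rewrite mcoeff_chain_map mcoeff0; apply/pE.
  (* d N = d - d h' d = (1 - d h') d, so the coefficient at s of d N is the coboundary of the
     coefficient at s of 1 - d h'. *)
  pose T : {linear bar k -> RG^o} :=
    bar_coef s \o (idfun \- (bar_diff k \o h')).
  exists (fun v => T (bar_basis R v)); apply/funext => t.
  rewrite coboundary_linear /T /= bar_coefE -mcoeff_chain_eval.
  rewrite chain_eval_boundary xE; congr (mcoeff s _).
  by rewrite NE raddfB raddfD /= bar_diffK add0r.
have [b bE] : exists b, chain_map p b = u by apply: chain_map_lift.
pose y := x - boundary b.
have /choice[e eE] s : exists e : cochain k (RG^o), mcoeff s y = coboundary e.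
  by apply/pE; rewrite -mcoeff_chain_map raddfB /= -boundary_chain_map bE uE subrr mcoeff0.
pose C := cochain_ext c.
have Cd z : C (bar_diff k.+1 z) = 0.
  rewrite cochain_ext_diff c0; move: z.
  by apply: (linear_bar_eq (g := \0)) => s; rewrite cochain_extE.
(* As C kills d, C = C h' d + C N. Here N is [y] plus a map with values in the boundaries, and the
   coefficients of [y] are the coboundaries of [e s]; hence the two summands. *)
exists ((fun v => C (h' (bar_basis R v))) +
        \sum_(s <- msupp y) (fun v => (e s v : RG) *: c s)).
rewrite raddfD raddf_sum; apply/funext => t.
have /(canRL (subrK _)) tE := esym (hE (bar_basis R t)).
have -> : c t = C (h' (bar_diff k (bar_basis R t))) + C (N (bar_basis R t)).
  transitivity (C (bar_basis R t)); first by rewrite cochain_extE.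
  by rewrite {1}tE !(raddfD C) [X in X + _ + _]Cd add0r.
rewrite -[RHS]/(coboundary _ t + (\sum_(s <- _) _) t) cochain_sumE.
rewrite (coboundary_linear (C \o h')); congr (_ + _).
have -> : N (bar_basis R t) =
    chain_eval t y + bar_diff k.+1 (chain_eval t b).
  by rewrite -chain_eval_boundary -xE -raddfD subrK.
rewrite (raddfD C) [X in _ + X = _]Cd addr0.
have /free_sum-> : (msupp (chain_eval t y) `<=` msupp y)%fset.
  apply/fsubsetP => s; rewrite -!mcoeff_neq0 mcoeff_chain_eval.
  by apply: contraNneq => ->.
rewrite raddf_sum; apply: eq_bigr => s _.
rewrite [RHS]coboundaryZr -eE -mcoeff_chain_eval.
transitivity (mcoeff s (chain_eval t y) *: C (bar_basis R s)).
  by rewrite -linearZ_LR.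
by rewrite [X in _ *: X]cochain_extE.
Qed.

Definition cohomology_vanish (A : lmodType RG) n : Prop :=
  forall c, @coboundary _ _ A n c = 0 -> exists c', c = coboundary_to A n c'.

Lemma cohomology_vanishP (A : lmodType RG) n :
  cohomology_vanish A n <-> forall x : group_cohomology A n, x = 0.
Proof. by rewrite homology_eq0P. Qed.

Lemma cohomology_vanish_FP k : type_FP R G k.+1 ->
  (forall W : lmodType RG, homology_vanish W k.+1) ->
  forall A : lmodType RG, cohomology_vanish A k.+1.
Proof.
move=> [P [d [eps [resP fgP]]]] HW A c c0.
have [f [g [h [h' hE]]]] := comparison_homotopy resP k.
have [s sE] := fgP k.+1 (leqnn _).
(* Left multiplication by elements of RG does not enlarge the support in the basis of tuples, so the
   supports of the images of the generators suffice. *)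
pose D := \big[fsetU/fset0]_(i < size s) msupp (g (nth 0 s i)).
apply: (cohomology_vanish_finite_rank (N := g \o f) (D := D) hE) => // x /=.
have [a ->] := sE (f x); rewrite raddf_sum /=.
apply/fsubsetP => t; apply: contraTT => tD.
rewrite -mcoeff_neq0 negbK raddf_sum big1 //= => i _.
rewrite linearZ_LR mcoeffZ [X in _ * X]mcoeff_outdom ?mulr0 //.
apply: contraNN tD => tg; apply/bigfcupP; exists i => //.
by rewrite mem_index_enum.
Qed.

End FiniteRank.

(** * Locally finite chains *)

Lemma mem_fset_set (T : choiceType) (X : set T) x :
  finite_set X -> X x -> x \in fset_set X.
Proof. by move=> finX Xx; rewrite in_fset_set //; apply: mem_set. Qed.

Section Push.
Variable A : zmodType.
Implicit Types S T U : choiceType.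

Definition proper_on S T (p : S -> T) (c : S -> A) : Prop :=
  forall t, finite_set [set s | p s = t /\ c s != 0].

(* summation along the fibres of p, meaningful only if p is proper on c *)
Definition push S T (p : S -> T) (c : S -> A) : T -> A := fun t =>
  \sum_(s <- fset_set [set s | p s = t /\ c s != 0]) c s.

Lemma pushE S T (p : S -> T) (c : S -> A) t (X : {fset S}) :
  (forall s, p s = t -> c s != 0 -> s \in X) ->
  push p c t = \sum_(s <- X | p s == t) c s.
Proof.
move=> XP; have fin : finite_set [set s | p s = t /\ c s != 0].
  by apply: (sub_finite_set _ (finite_fset X)) => s [/XP].
rewrite [RHS](bigID (fun s => c s == 0)) /= big1 ?add0r => [|s]; last first.
  by case/andP=> _ /eqP.
rewrite -[RHS]big_filter /push; apply: perm_big; apply: uniq_perm.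
- exact: fset_uniq.
- exact/filter_uniq/fset_uniq.
move=> s; rewrite in_fset_set // mem_filter; apply/idP/idP.
  by move/set_mem => -[/[dup] /XP sX -> cs]; rewrite eqxx cs sX.
by case/andP=> /andP[/eqP ps cs] _; apply/mem_set.
Qed.

Lemma push_neq0 S T (p : S -> T) (c : S -> A) t :
  push p c t != 0 -> exists2 s, p s = t & c s != 0.
Proof.
apply: contraPP => /forall2NP ps; rewrite /push big1_seq ?eqxx // => s.
have -> : [set s | p s = t /\ c s != 0] = set0.
  by apply/seteqP; split=> // u [pu cu]; have [] := ps u.
by rewrite fset_set0.
Qed.

Lemma push_sum S T (p : S -> T) n (c : 'I_n -> S -> A) (m : 'I_n -> int) :
  (forall i, proper_on p (c i)) ->
  push p (fun s => \sum_(i < n) c i s *~ m i) =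
  (fun t => \sum_(i < n) push p (c i) t *~ m i).
Proof.
move=> pc; apply/funext => t.
pose X := \big[fsetU/fset0]_(i < n)
  fset_set [set s | p s = t /\ c i s != 0].
have XP i s : p s = t -> c i s != 0 -> s \in X.
  move=> ps cs; apply/bigfcupP; exists i; first by rewrite mem_index_enum.
  exact: (mem_fset_set (pc i t)).
rewrite (pushE (X := X)) => [|s ps].
  rewrite exchange_big; apply: eq_bigr => i _ /=.
  by rewrite (pushE (XP i)) mulrz_suml.
apply: contraNT => sX; rewrite big1 // => i _.
suff /eqP-> : c i s == 0 by rewrite mul0rz.
by apply: contraNT sX => /(XP i s ps).
Qed.

Lemma pushB S T (p : S -> T) (c d : S -> A) :
  proper_on p c -> proper_on p d -> push p (c - d) = push p c - push p d.
Proof.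
move=> pc pd; pose e (i : 'I_2) := if i == ord0 then c else d.
pose m (i : 'I_2) : int := if i == ord0 then 1 else -1.
have -> : c - d = (fun s => \sum_(i < 2) e i s *~ m i).
  by apply/funext => s; rewrite big_ord_recl big_ord1 /e /m /= mulrN1z.
rewrite push_sum => [|i]; last by rewrite /e; case: ifP.
by apply/funext => t; rewrite big_ord_recl big_ord1 /e /m /= mulrN1z.
Qed.

Lemma proper_push S T U (p : S -> T) (q : T -> U) (c : S -> A) :
  proper_on (q \o p) c -> proper_on q (push p c).
Proof.
move=> qp u; apply: (sub_finite_set _ (finite_image p (qp u))).
by move=> t [qt /push_neq0[s ps cs]]; exists s => //; split; rewrite //= ps.
Qed.

Lemma push_comp S T U (p : S -> T) (q : T -> U) (c : S -> A) :
  proper_on (q \o p) c -> push q (push p c) = push (q \o p) c.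
Proof.
move=> qp; apply/funext => u.
pose X := fset_set [set s | (q \o p) s = u /\ c s != 0].
have XP s : (q \o p) s = u -> c s != 0 -> s \in X.
  by move=> qs cs; apply: (mem_fset_set (qp u)).
pose Y := [fset p s | s in X]%fset.
rewrite (pushE (X := Y)) => [|t qt /push_neq0[s ps cs]]; last first.
  by apply/imfsetP; exists s; rewrite // XP //= ps.
rewrite (pushE XP).
transitivity (\sum_(t <- Y | q t == u) \sum_(s <- X | p s == t) c s).
  apply: eq_bigr => t /eqP qt; apply: pushE => s ps cs.
  by apply: XP; rewrite //= ps.
rewrite (exchange_big_dep (fun s => q (p s) == u)) /= => [|t s]; last first.
  by move=> /eqP <- /eqP ->.
rewrite big_seq_cond [RHS]big_seq_cond; apply: eq_bigr => s /andP[sX /eqP qs].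
have pY : p s \in Y by apply/imfsetP; exists s.
rewrite big_mkcond (bigD1_seq (p s)) ?fset_uniq //= qs !eqxx /=.
rewrite big1 ?addr0 // => t; rewrite [_ == t]eq_sym => /negbTE ->.
by rewrite andbF.
Qed.

Lemma proper_inj S T (p : S -> T) (c : S -> A) : injective p -> proper_on p c.
Proof.
move=> p_inj t; have [[s [ps cs]]|nex] :=
    pselect (exists s, p s = t /\ c s != 0).
  apply: (sub_finite_set _ (finite_set1 s)) => u [pu _] /=.
  by apply: p_inj; rewrite ps.
apply: (sub_finite_set _ (finite_set0 S)) => s pcs.
by case: nex; exists s.
Qed.

Lemma push_inj S T (p : S -> T) (c : S -> A) s : injective p ->
  push p c (p s) = c s.
Proof.
move=> p_inj; rewrite (pushE (X := [fset s]%fset)) => [|t /p_inj-> _].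
  by rewrite big_mkcond big_seq_fset1 eqxx.
by rewrite inE.
Qed.

Lemma eq_push S T (p q : S -> T) (c : S -> A) :
  (forall s, c s != 0 -> p s = q s) -> push p c = push q c.
Proof.
move=> pq; apply/funext => t; rewrite /push; congr (bigop _ _ _).
have -> // : [set s | p s = t /\ c s != 0] = [set s | q s = t /\ c s != 0].
by apply/seteqP; split=> s [<- cs]; rewrite /= pq.
Qed.

Lemma push_id S (p : S -> S) (c : S -> A) :
  (forall s, c s != 0 -> p s = s) -> push p c = c.
Proof.
move=> /(@eq_push _ _ _ id)->; apply/funext => s.
exact: (@push_inj _ _ id).
Qed.

Definition alt_push S T n (f : nat -> S -> T) (c : S -> A) : T -> A := fun t =>
  \sum_(i < n) push (f i) c t *~ (-1) ^+ i.

Lemma alt_push_neq0 S T n (f : nat -> S -> T) (c : S -> A) t :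
  alt_push n f c t != 0 ->
  exists2 i, (i < n)%N & exists2 s, f i s = t & c s != 0.
Proof.
apply: contraPP => ps; rewrite /alt_push big1 ?eqxx // => i _.
suff /eqP-> : push (f i) c t == 0 by rewrite mul0rz.
by apply: contra_notT ps => /push_neq0; exists i.
Qed.

Lemma alt_pushB S T n (f : nat -> S -> T) (c d : S -> A) :
  (forall i, proper_on (f i) c) -> (forall i, proper_on (f i) d) ->
  alt_push n f (c - d) = alt_push n f c - alt_push n f d.
Proof.
move=> fc fd; apply/funext => t.
rewrite -[RHS]/(alt_push n f c t - alt_push n f d t) /alt_push -sumrB.
apply: eq_bigr => i _; rewrite pushB //.
by rewrite -[(_ - _) t]/(push _ c t - push _ d t) mulrzBl.
Qed.

Lemma push_alt_push S T U m (p : T -> U) (g : nat -> S -> T) (c : S -> A) :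
  (forall j, proper_on (p \o g j) c) ->
  push p (alt_push m g c) =
  fun u => \sum_(j < m) push (p \o g j) c u *~ (-1) ^+ j.
Proof.
move=> pg; rewrite (push_sum (c := fun i : 'I_m => push (g i) c)).
  by apply/funext => u; apply: eq_bigr => j _; rewrite push_comp.
by move=> j; apply: proper_push.
Qed.

Lemma alt_push_alt_push S T U n m (f : nat -> T -> U) (g : nat -> S -> T)
    (c : S -> A) :
  (forall i j, proper_on (f i \o g j) c) ->
  alt_push n f (alt_push m g c) = fun u => \sum_(i < n) \sum_(j < m)
    push (f i \o g j) c u *~ ((-1) ^+ i * (-1) ^+ j).
Proof.
move=> fg; apply/funext => u; apply: eq_bigr => i _.
rewrite push_alt_push // mulrz_suml; apply: eq_bigr => j _.
by rewrite mulrzAC -mulrzA mulrC.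
Qed.

(** The cancellation behind d d = 0: in the induction step the entries (i, n+1) of the last column
    cancel the entries (n, i) of the last row. *)
Lemma alternating_sum_eq0 (u : nat -> nat -> A) n :
  (forall i j, (i < j <= n)%N -> u i j = u j.-1 i) ->
  \sum_(i < n) \sum_(j < n.+1) u i j *~ ((-1) ^+ i * (-1) ^+ j) = 0.
Proof.
elim: n => [|n IHn] uE; first by rewrite big_ord0.
rewrite big_ord_recr /=.
under eq_bigr => i _ do rewrite big_ord_recr /=.
rewrite big_split /= IHn => [|i j /andP[ij jn]]; last first.
  by rewrite uE // ij leqW.
rewrite add0r !big_ord_recr /= (uE n n.+1) ?ltnSn //= -addrA -mulrzDr.
rewrite exprS mulN1r mulrN subrr mulr0z addr0 -big_split big1 // => i _ /=.
have /uE-> : (i < n.+1 <= n.+1)%N by rewrite ltnS (ltnW (ltn_ord i)) leqnn.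
by rewrite /= -mulrzDr mulrN mulrC addNr.
Qed.

Lemma alt_push_square S T U n (f : nat -> T -> U) (g : nat -> S -> T)
    (c : S -> A) :
  (forall i j, proper_on (f i \o g j) c) ->
  (forall i j s, (i < j <= n)%N -> f i (g j s) = f j.-1 (g i s)) ->
  alt_push n f (alt_push n.+1 g c) = 0.
Proof.
move=> fg fgE; rewrite alt_push_alt_push //; apply/funext => u.
apply: (alternating_sum_eq0 (u := fun i j => push (f i \o g j) c u)) => i j ij.
by congr (_ u); apply: eq_push => s _; apply: fgE.
Qed.

Lemma alt_push_commute S T T' U n m (f : nat -> T -> U) (g : nat -> S -> T)
    (f' : nat -> S -> T') (g' : nat -> T' -> U) (c : S -> A) :
  (forall i j, proper_on (f i \o g j) c) ->
  (forall i j s, f i (g j s) = g' j (f' i s)) ->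
  alt_push n f (alt_push m g c) = alt_push m g' (alt_push n f' c).
Proof.
move=> fg fgE; have fgE' i j : f i \o g j = g' j \o f' i.
  by apply/funext => s; apply: fgE.
rewrite !alt_push_alt_push // => [|i j]; last by rewrite -fgE'.
apply/funext => u; rewrite exchange_big; apply: eq_bigr => j _.
by apply: eq_bigr => i _; rewrite fgE' mulrC.
Qed.

Lemma eq_proper_on S T (p q : S -> T) (c : S -> A) :
  (forall s, c s != 0 -> p s = q s) -> proper_on p c -> proper_on q c.
Proof.
move=> pq pc t; apply: (sub_finite_set _ (pc t)) => s [qs cs].
by split=> //; rewrite pq.
Qed.

Lemma proper_on_injl S T U (p : S -> T) (l : T -> U) (c : S -> A) :
  injective l -> proper_on p c -> proper_on (l \o p) c.
Proof.
move=> l_inj pc u; have [[t <-]|nt] := pselect (exists t, l t = u).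
  apply: (sub_finite_set _ (pc t)) => s [/l_inj fs cs].
  by split.
apply: (sub_finite_set _ (finite_set0 _)) => s [ls _].
by case: nt; exists (p s).
Qed.

Lemma alt_push_transport S T S' T' n (f : nat -> S -> T) (f' : nat -> S' -> T')
    (k : S -> S') (l : T -> T') (c : S -> A) :
  (forall i, proper_on (f i) c) -> injective l ->
  (forall i s, f' i (k s) = l (f i s)) ->
  alt_push n f' (push k c) = push l (alt_push n f c).
Proof.
move=> fc l_inj f'k; have lfc i := proper_on_injl l_inj (fc i).
rewrite push_alt_push //; apply/funext => t; apply: eq_bigr => i _.
have f'kE : f' i \o k = l \o f i by apply/funext => s; apply: f'k.
by rewrite push_comp f'kE.
Qed.

Lemma alt_push_cone S T U n (f : nat -> S -> U) (k : S -> T) (g : nat -> T -> S)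
    (l : U -> S) (c : S -> A) :
  (forall i, proper_on (f i) c) -> injective l ->
  (forall s, c s != 0 -> g 0 (k s) = s) ->
  (forall i s, c s != 0 -> g i.+1 (k s) = l (f i s)) ->
  alt_push n f c = 0 -> c = alt_push n.+1 g (push k c).
Proof.
move=> fc l_inj gk0 gkS fc0.
have lfc i : proper_on (l \o f i) c by apply: proper_on_injl.
have := push_alt_push n lfc; rewrite fc0 => l0.
apply/funext => s; have {}l0 := congr1 (fun h : S -> A => h s) l0.
 rewrite /alt_push big_ord_recl.
have kc0 : proper_on (g 0%N \o k) c.
  by apply: (eq_proper_on (p := id)) => [t /gk0|]; [|apply: proper_inj].
rewrite push_comp // push_id // expr0 mulr1z -[LHS]addr0; congr (_ + _).
transitivity (- push l (0 : U -> A) s).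
  by rewrite /push big1 ?oppr0.
rewrite l0 -sumrN; apply: eq_bigr => i _.
rewrite push_comp; last by apply: (eq_proper_on _ (lfc i)) => t ct; exact/esym/gkS.
rewrite exprS mulN1r mulrNz; congr (- (_ s *~ _)).
by apply: eq_push => t ct; apply/esym/gkS.
Qed.

End Push.

(** * The double complex of a coarse embedding *)

Section Simplices.
Variable K : groupType.

(** Since s_i = v_{i-1} v_i^-1 for the successive vertices v_i of a simplex, finitely many tuples s
    mean simplices of uniformly bounded size. *)
Definition stuple n : choiceType :=
  match n with 0 => unit | m.+1 => m.-tuple K end.

(* (s, y) is the simplex with vertices y, s_1^-1 y, s_2^-1 s_1^-1 y, ...; the
   dimension is shifted by one in order to include the empty simplex *)
Definition simplex n : choiceType :=
  match n with 0 => unit | m.+1 => (m.-tuple K * K)%type end.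

Definition labels n : simplex n -> stuple n :=
  match n with 0 => id | m.+1 => fst end.

Definition vertex n : simplex n -> option K :=
  match n with 0 => fun=> None | m.+1 => fun x => Some x.2 end.

Definition sface n (i : nat) : simplex n.+1 -> simplex n :=
  match n with
  | 0 => fun=> tt
  | m.+1 => fun x =>
      (face i x.1, if i == 0 then ((thead x.1)^-1 * x.2)%g else x.2)
  end.

Definition lface n (i : nat) : stuple n.+1 -> stuple n :=
  match n with 0 => fun=> tt | m.+1 => face i end.

Definition scone n (v : K) : simplex n -> simplex n.+1 :=
  match n with
  | 0 => fun=> ([tuple], v)
  | m.+1 => fun x => ([tuple of (v * x.2^-1)%g :: x.1], v)
  end.

(** The first labels, by which face 0 displaces the first vertex; a simplex with a single vertex has
    none. *)
Definition heads n : set (stuple n.+1) -> set K :=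
  match n with 0 => fun=> set0 | m.+1 => fun T => [set thead t | t in T] end.

Lemma finite_heads n (T : set (stuple n.+1)) :
  finite_set T -> finite_set (heads T).
Proof.
case: n T => [|n] T fT; first exact: finite_set0.
exact: (finite_image (fun t : n.+1.-tuple K => thead t)).
Qed.

Definition lcone n (E : set K) : set (stuple n) -> set (stuple n.+1) :=
  match n with
  | 0 => fun=> [set [tuple]]
  | m.+1 => fun T => [set [tuple of g :: t] | g in E & t in T]
  end.

Lemma finite_lcone n (E : set K) (T : set (stuple n)) :
  finite_set E -> finite_set T -> finite_set (lcone E T).
Proof.
case: n T => [|n] T fE fT; first exact: finite_set1.
exact: (finite_image2 (fun g (t : n.-tuple K) => [tuple of g :: t])).
Qed.

Lemma labels_cone n (E : set K) (T : set (stuple n)) v (x : simplex n) :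
  T (labels x) -> (forall y, vertex x = Some y -> E (v * y^-1)%g) ->
  lcone E T (labels (scone v x)).
Proof.
case: n T x => [//|n] T [s y] /= Ts EP.
by exists (v * y^-1)%g; [exact: EP|exists s].
Qed.

Lemma vertex_cone n v (x : simplex n) : vertex (scone v x) = Some v.
Proof. by case: n x. Qed.

Lemma labels_sface n i (x : simplex n.+1) :
  labels (sface i x) = lface i (labels x).
Proof. by case: n x. Qed.

Lemma sface0_cone n v (x : simplex n) : sface 0 (scone v x) = x.
Proof.
case: n x => [[] //|n [s y]] /=; rewrite face0_cons; congr (_, _).
by rewrite /thead (tnth_nth 1%g) /= invgM invgK mulgVK.
Qed.

Lemma sfaceS_cone n i v (x : simplex n.+1) :
  sface i.+1 (scone v x) = scone v (sface i x).
Proof.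
case: n x => [|n] [s y] /=; congr (_, _); first by rewrite [LHS]tuple0.
case: i => [|i]; last exact: faceSS_cons.
by rewrite face1_cons invgM invgK mulgA.
Qed.

Lemma scone_vertex n (x : simplex n.+1) : scone x.2 (sface 0 x) = x.
Proof.
case: n x => [|n] [s y]; first by rewrite [s]tuple0.
case/tupleP: s => g s.
rewrite -[sface 0 _]/(face 0 _, _) face0_cons /= theadE invgM invgK.
by rewrite mulgA mulgV mul1g.
Qed.

(** A nonempty simplex is the cone over its face 0, and the higher faces of a cone are cones over
    faces, so the identity descends to lower dimension. *)
Lemma sface_sface n i j (x : simplex n.+2) : (i < j)%N ->
  sface i (sface j x) = sface j.-1 (sface i x).
Proof.
elim: n i j x => [|n IHn] i [|j] // x ij.
rewrite -(scone_vertex x) sfaceS_cone.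
case: i ij => [|i] ij; first by rewrite !sface0_cone.
case: j ij => [|j] // ij; by rewrite !sfaceS_cone IHn.
Qed.

End Simplices.

(** * Controlled functions on pairs of simplices *)

Section ControlledChains.
Variables (G H : groupType) (phi : G -> H) (A : zmodType).
Hypothesis phi_emb : coarse_embedding phi.

Definition bisimplex a b : choiceType := (simplex G a * simplex H b)%type.

Definition hface a b i (x : bisimplex a.+1 b) : bisimplex a b :=
  (sface i x.1, x.2).
Definition vface a b i (x : bisimplex a b.+1) : bisimplex a b :=
  (x.1, sface i x.2).

(* a missing vertex of x.1 is interpreted as an arbitrary element of G *)
Definition near_by a b (F : set H) (x : bisimplex a b) : Prop :=
  forall y, vertex x.2 = Some y ->
  exists g, (forall g', vertex x.1 = Some g' -> g' = g) /\
            F (y * (phi g)^-1)%g.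

(** Simplices of bounded size whose first vertices correspond under phi up to the finite set F. For
    a = 0 this asks for simplices of H near phi(G), for b = 0 only for bounded simplices of G: the
    two edges are the complexes to be compared. *)
Definition controlled a b (S : set (bisimplex a b)) : Prop :=
  exists (T1 : set (stuple G a)) (T2 : set (stuple H b)) (F : set H),
    [/\ finite_set T1, finite_set T2, finite_set F &
        forall x, S x -> [/\ T1 (labels x.1), T2 (labels x.2) & near_by F x]].

Lemma controlled_sub a b (S S' : set (bisimplex a b)) :
  S `<=` S' -> controlled S' -> controlled S.
Proof.
move=> SS' [T1 [T2 [F [fT1 fT2 fF SP]]]]; exists T1, T2, F; split=> // x /SS'.
exact: SP.
Qed.

Lemma controlled0 a b : controlled (set0 : set (bisimplex a b)).
Proof. by exists set0, set0, set0; split. Qed.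

Lemma controlledU a b (S S' : set (bisimplex a b)) :
  controlled S -> controlled S' -> controlled (S `|` S').
Proof.
move=> [T1 [T2 [F [fT1 fT2 fF SP]]]] [T1' [T2' [F' [fT1' fT2' fF' SP']]]].
exists (T1 `|` T1'), (T2 `|` T2'), (F `|` F'); split; rewrite ?finite_setU //.
move=> x [/SP|/SP'] [t1 t2 n]; split; try by [left|right].
- by move=> y /n[g [gE gF]]; exists g; split=> //; left.
- by move=> y /n[g [gE gF]]; exists g; split=> //; right.
Qed.

Lemma controlled_image_phi (E : set G) : finite_set E ->
  finite_set [set (phi p.1 * (phi p.2)^-1)%g | p in [set p | E (p.1 * p.2^-1)%g]].
Proof.
move=> fE; apply/phi_emb; apply: (sub_finite_set _ fE).
by move=> _ [p Ep <-].
Qed.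

Lemma controlled_preimage_phi (F : set H) : finite_set F ->
  finite_set [set (p.1 * p.2^-1)%g | p in
    [set p | F (phi p.1 * (phi p.2)^-1)%g]].
Proof.
move=> fF; apply/phi_emb; apply: (sub_finite_set _ fF).
by move=> _ [p Fp <-].
Qed.

Lemma finite_fibre_phi h : finite_set (phi @^-1` [set h]).
Proof.
have [[g0 g0h]|ng] := pselect (exists g, phi g = h); last first.
  apply: (sub_finite_set _ (finite_set0 _)) => g gh.
  by case: ng; exists g.
have := controlled_preimage_phi (finite_set1 1%g).
move=> /(finite_image (fun g => g * g0)%g); apply: sub_finite_set => g /= gh.
exists (g * g0^-1)%g; last by rewrite mulgVK.
by exists (g, g0); rewrite //= gh g0h mulgV.
Qed.

(** A face moves the first vertex g to some g' with g g'^-1 either 1 or a first label. By coarseness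
    phi(g) phi(g')^-1 stays in a finite set, by which F is enlarged. *)
Lemma controlled_hface a b i (S : set (bisimplex a.+1 b)) :
  controlled S -> controlled (@hface a b i @` S).
Proof.
move=> [T1 [T2 [F [fT1 fT2 fF SP]]]].
pose E := [set 1%g] `|` heads T1.
have fE : finite_set E.
  by rewrite finite_setU; split; [exact: finite_set1|exact: finite_heads].
pose P := [set (phi p.1 * (phi p.2)^-1)%g | p in [set p | E (p.1 * p.2^-1)%g]].
have fP : finite_set P by apply: controlled_image_phi.
exists (lface i @` T1), T2, [set (x * y)%g | x in F & y in P].
split; [exact: finite_image|by []|exact: finite_image2|].
move=> _ [x /SP[t1 t2 n] <-]; split=> //=.
  by exists (labels x.1) => //; rewrite labels_sface.
move=> y /n[g [gE gF]].
have [g' [g'E gg']] : exists g', (forall h, vertex (sface i x.1) = Some h ->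
    h = g') /\ E (g * g'^-1)%g.
  rewrite /E; case: a S T1 fT1 SP {E fE P fP} x t1 t2 n gE
    => [|a] S T1 fT1 SP x t1 t2 n gE.
    by exists g; split=> //; left; rewrite mulgV.
  exists (if i == 0 then ((thead x.1.1)^-1 * g)%g else g); split=> [h [<-]|].
    by rewrite (gE _ erefl).
  case: ifP => _; last by left; rewrite mulgV.
  by right; exists x.1.1; rewrite // invgM invgK mulgA mulgV mul1g.
exists g'; split=> //; exists (y * (phi g)^-1)%g => //.
exists (phi g * (phi g')^-1)%g; last by rewrite mulgA mulgVK.
by exists (g, g').
Qed.

Lemma controlled_vface a b i (S : set (bisimplex a b.+1)) :
  controlled S -> controlled (@vface a b i @` S).
Proof.
move=> [T1 [T2 [F [fT1 fT2 fF SP]]]].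
exists T1, (lface i @` T2),
  (F `|` [set (x^-1 * y)%g | x in heads T2 & y in F]).
split; [by []|exact: finite_image| |].
  rewrite finite_setU; split=> //; apply: finite_image2 => //.
  exact: finite_heads.
move=> _ [x /SP[t1 t2 n] <-]; split=> //=.
  by exists (labels x.2) => //; rewrite labels_sface.
case: b S T2 fT2 SP x t1 t2 n => [//|b] S T2 fT2 SP x t1 t2 n y /= [<-].
have [g [gE gF]] := n _ erefl.
exists g; split=> //; case: ifP => _; last by left.
right; exists (thead x.2.1); first by exists x.2.1.
by eexists; first exact: gF; rewrite mulgA.
Qed.

(** The first vertex y of the simplex of H confines the first vertex of the simplex of G to the
    finite set phi^-1(F^-1 y), and the labels are finite in number. *)
Lemma proper_hface a b i (S : set (bisimplex a.+1 b.+1)) x' :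
  controlled S -> finite_set [set x | @hface a b.+1 i x = x' /\ S x].
Proof.
move=> [T1 [T2 [F [fT1 fT2 fF SP]]]].
have fP : finite_set (phi @^-1` [set (f^-1 * x'.2.2)%g | f in F]).
  have -> : phi @^-1` [set (f^-1 * x'.2.2)%g | f in F] =
      \bigcup_(f in F) (phi @^-1` [set (f^-1 * x'.2.2)%g]).
    by apply/seteqP; split=> g [f Ff fE]; exists f.
  by apply: bigcup_finite => // f _; apply: finite_fibre_phi.
apply: (sub_finite_set _ (finite_setX (finite_setX fT1 fP) (finite_set1 x'.2))).
move=> x [<- /SP[t1 t2 n]]; split=> //; split=> //=.
have [g [gE gF]] := n _ erefl; rewrite (gE _ erefl).
by eexists; first exact: gF; rewrite invgM invgK mulgVK.
Qed.

Lemma proper_vface a b i (S : set (bisimplex a.+1 b.+1)) x' :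
  controlled S -> finite_set [set x | @vface a.+1 b i x = x' /\ S x].
Proof.
move=> [T1 [T2 [F [fT1 fT2 fF SP]]]].
pose P := [set (f * phi x'.1.2)%g | f in F].
have fP : finite_set P by apply: finite_image.
apply: (sub_finite_set _ (finite_setX (finite_set1 x'.1) (finite_setX fT2 fP))).
move=> x [/(congr1 fst) /= xx' /SP[t1 t2 n]]; split=> //; split=> //=.
have [g [gE gF]] := n _ erefl; eexists; first exact: gF.
by rewrite -xx' (gE _ erefl) mulgVK.
Qed.

Definition hcone a b (v : simplex H b -> G) (x : bisimplex a b) :
  bisimplex a.+1 b := (scone (v x.2) x.1, x.2).
Definition vcone a b (v : simplex G a -> H) (x : bisimplex a b) :
  bisimplex a b.+1 := (x.1, scone (v x.1) x.2).

Lemma hcone_inj a b v : injective (@hcone a b v).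
Proof.
by apply: (can_inj (g := hface 0)) => -[x y]; rewrite /hface /= sface0_cone.
Qed.

Lemma vcone_inj a b v : injective (@vcone a b v).
Proof.
by apply: (can_inj (g := vface 0)) => -[x y]; rewrite /vface /= sface0_cone.
Qed.

Lemma controlled_vcone a b (S : set (bisimplex a.+1 b)) :
  controlled S -> controlled (vcone (fun x : simplex G a.+1 => phi x.2) @` S).
Proof.
move=> [T1 [T2 [F [fT1 fT2 fF SP]]]].
exists T1, (lcone [set f^-1%g | f in F] T2), [set 1%g].
split=> //; first by apply: finite_lcone => //; apply: finite_image.
move=> _ [x /SP[t1 t2 n] <-]; split=> //=.
  apply: labels_cone => // y /n[g [gE gF]]; rewrite (gE _ erefl).
  by eexists; first exact: gF; rewrite invgM invgK.
move=> y; rewrite vertex_cone => -[<-]; exists x.1.2.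
by split=> [_ [<-] //|]; rewrite /= mulgV.
Qed.

(** Here [psi] depends on S through F. If y is F-close to phi(g), it is also F-close to phi(psi(y)),
    so phi(psi(y)) phi(g)^-1 lies in F^-1 F; as phi is an embedding, the new label psi(y) g^-1 stays
    in a finite set. *)
Lemma controlled_hcone a b (S : set (bisimplex a b.+1)) : controlled S ->
  exists psi : H -> G, controlled (hcone (fun x : simplex H b.+1 => psi x.2) @` S).
Proof.
move=> [T1 [T2 [F [fT1 fT2 fF SP]]]].
have /choice[psi psiP] y : exists g, 
    (exists g', F (y * (phi g')^-1)%g) -> F (y * (phi g)^-1)%g.
  have [[g gF]|ng] := pselect (exists g, F (y * (phi g)^-1)%g).
    by exists g.
  by exists 1%g.
exists psi.
pose F2 := [set (f^-1 * f')%g | f in F & f' in F].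
pose E := [set (p.1 * p.2^-1)%g | p in [set p | F2 (phi p.1 * (phi p.2)^-1)%g]].
have fE : finite_set E by apply/controlled_preimage_phi/finite_image2.
exists (lcone E T1), T2, F; split=> //; first exact: finite_lcone.
move=> _ [x /SP[t1 t2 n] <-]; have [g [gE gF]] := n _ erefl.
have psiF : F (x.2.2 * (phi (psi x.2.2))^-1)%g by apply: psiP; exists g.
split=> //=.
  apply: labels_cone => // h /gE ->; exists (psi x.2.2, g) => //=.
  eexists; [exact: psiF|eexists; [exact: gF|]].
  by rewrite invgM invgK mulgA mulgVK.
move=> y [<-]; exists (psi x.2.2); split=> // g'.
by rewrite vertex_cone => -[].
Qed.

Definition chain_controlled a b (c : bisimplex a b -> A) : Prop :=
  controlled [set x | c x != 0].

Definition hdiff a b : (bisimplex a.+1 b -> A) -> bisimplex a b -> A :=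
  alt_push a.+1 (@hface a b).
Definition vdiff a b : (bisimplex a b.+1 -> A) -> bisimplex a b -> A :=
  alt_push b.+1 (@vface a b).

Lemma controlled_bigcup a b n (S : nat -> set (bisimplex a b)) :
  (forall i, controlled (S i)) -> controlled [set x | exists2 i, (i < n)%N & S i x].
Proof.
move=> SP; elim: n => [|n IHn].
  by apply: controlled_sub (controlled0 a b) => x [i]; rewrite ltn0.
apply: controlled_sub (controlledU IHn (SP n)) => x [i].
by rewrite ltnS leq_eqVlt => /predU1P[->|ij] Sx; [right|left; exists i].
Qed.

Lemma controlled_alt_push a b a' b' n (f : nat -> bisimplex a b -> bisimplex a' b')
    (c : bisimplex a b -> A) :
  (forall i S, controlled S -> controlled (f i @` S)) ->
  chain_controlled c -> chain_controlled (alt_push n f c).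
Proof.
move=> fS cc; apply: controlled_sub (controlled_bigcup n (fun i => fS i _ cc)).
by move=> x /alt_push_neq0[i ltin [y fy cy]]; exists i => //; exists y.
Qed.

Lemma controlledB a b (c d : bisimplex a b -> A) :
  chain_controlled c -> chain_controlled d -> chain_controlled (c - d).
Proof.
move=> cc cd; apply: controlled_sub (controlledU cc cd) => x /=.
apply: contraPP => /not_orP[/negP/negPn/eqP cx /negP/negPn/eqP dx].
by rewrite -[(c - d) x]/(c x - d x) cx dx subrr eqxx.
Qed.

Lemma controlled_push (S : choiceType) a b (f : S -> bisimplex a b)
    (c : S -> A) :
  controlled (f @` [set x | c x != 0]) -> chain_controlled (push f c).
Proof.
by apply: controlled_sub => x /push_neq0[y fy cy]; exists y.
Qed.

Lemma proper_hface_on a b i (c : bisimplex a.+1 b.+1 -> A) :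
  chain_controlled c -> proper_on (@hface a b.+1 i) c.
Proof. by move=> cc x; apply: proper_hface cc. Qed.

Lemma proper_vface_on a b i (c : bisimplex a.+1 b.+1 -> A) :
  chain_controlled c -> proper_on (@vface a.+1 b i) c.
Proof. by move=> cc x; apply: proper_vface cc. Qed.

Lemma proper_on_comp (S T U : choiceType) (p : S -> T) (q : T -> U) (c : S -> A) :
  proper_on p c ->
  (forall u, finite_set [set t | q t = u /\ (p @` [set s | c s != 0]) t]) ->
  proper_on (q \o p) c.
Proof.
move=> pc qc u.
have := bigcup_finite (qc u) (fun t _ => pc t).
apply: sub_finite_set => s [/= qs cs]; exists (p s) => //.
by split=> //; exists s.
Qed.

Lemma controlled_hdiff a b (c : bisimplex a.+1 b -> A) :
  chain_controlled c -> chain_controlled (hdiff c).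
Proof. by apply: controlled_alt_push => i S; apply: controlled_hface. Qed.

Lemma controlled_vdiff a b (c : bisimplex a b.+1 -> A) :
  chain_controlled c -> chain_controlled (vdiff c).
Proof. by apply: controlled_alt_push => i S; apply: controlled_vface. Qed.

Lemma hdiffB a b (c d : bisimplex a.+1 b.+1 -> A) :
  chain_controlled c -> chain_controlled d -> hdiff (c - d) = hdiff c - hdiff d.
Proof.
by move=> cc cd; apply: alt_pushB => i; apply: proper_hface_on.
Qed.

Lemma vdiffB a b (c d : bisimplex a.+1 b.+1 -> A) :
  chain_controlled c -> chain_controlled d -> vdiff (c - d) = vdiff c - vdiff d.
Proof.
by move=> cc cd; apply: alt_pushB => i; apply: proper_vface_on.
Qed.

Lemma hdiffK a b (c : bisimplex a.+2 b.+1 -> A) :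
  chain_controlled c -> hdiff (hdiff c) = 0.
Proof.
move=> cc; apply: alt_push_square => [i j|i j s /andP[ij _]].
  apply: proper_on_comp; first exact: proper_hface_on.
  by move=> u; apply/proper_hface/controlled_hface.
by rewrite /hface /= sface_sface.
Qed.

Lemma vdiffK a b (c : bisimplex a.+1 b.+2 -> A) :
  chain_controlled c -> vdiff (vdiff c) = 0.
Proof.
move=> cc; apply: alt_push_square => [i j|i j s /andP[ij _]].
  apply: proper_on_comp; first exact: proper_vface_on.
  by move=> u; apply/proper_vface/controlled_vface.
by rewrite /vface /= sface_sface.
Qed.

(* Both differentials into bidegree (0, 0) may be improper, which accounts for
   the two versions of the commutation lemma. *)
Lemma vdiff_hdiff a b (c : bisimplex a.+2 b.+1 -> A) :
  chain_controlled c -> vdiff (hdiff c) = hdiff (vdiff c).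
Proof.
move=> cc; apply: alt_push_commute => // i j.
apply: proper_on_comp; first exact: proper_hface_on.
by move=> u; apply/proper_vface/controlled_hface.
Qed.

Lemma hdiff_vdiff a b (c : bisimplex a.+1 b.+2 -> A) :
  chain_controlled c -> hdiff (vdiff c) = vdiff (hdiff c).
Proof.
move=> cc; apply: alt_push_commute => // i j.
apply: proper_on_comp; first exact: proper_vface_on.
by move=> u; apply/proper_hface/controlled_vface.
Qed.

(** * Exactness of the columns over nonempty simplices of G and of the rows over nonempty simplices
    of H *)

Lemma vdiff_surj a (c : bisimplex a.+1 0 -> A) : chain_controlled c ->
  exists2 c', chain_controlled c' & c = vdiff c'.
Proof.
move=> cc; exists (push (vcone (fun x : simplex G a.+1 => phi x.2)) c).
  exact/controlled_push/controlled_vcone.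
(* On the empty simplex the cycle condition is the empty sum, the case n = 0 of [alt_push_cone]; [f]
   and [l] are placeholders. *)
apply: (alt_push_cone (f := fun=> id) (l := id)) => //.
- by move=> i; apply: proper_inj.
- by move=> -[x []].
- by move=> i [x []].
by apply/funext => x; apply: big_ord0.
Qed.

Lemma vdiff_exact a b (c : bisimplex a.+1 b.+1 -> A) : chain_controlled c ->
  vdiff c = 0 -> exists2 c', chain_controlled c' & c = vdiff c'.
Proof.
move=> cc; pose v (x : simplex G a.+1) := phi x.2 => c0.
exists (push (vcone v) c); first exact/controlled_push/controlled_vcone.
apply: alt_push_cone c0 => [i||[x y] _|i [x y] _].
- exact: proper_vface_on.
- exact: (@vcone_inj _ _ v).
- exact: (congr1 (pair x) (sface0_cone (v x) y)).
exact: (congr1 (pair x) (sfaceS_cone i (v x) y)).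
Qed.

Lemma hdiff_surj b (c : bisimplex 0 b.+1 -> A) : chain_controlled c ->
  exists2 c', chain_controlled c' & c = hdiff c'.
Proof.
move=> cc; have [psi psiP] := controlled_hcone cc.
exists (push (hcone (fun x : simplex H b.+1 => psi x.2)) c).
  exact: controlled_push.
apply: (alt_push_cone (f := fun=> id) (l := id)) => //.
- by move=> i; apply: proper_inj.
- by move=> -[[] x].
- by move=> i [[] x].
by apply/funext => x; apply: big_ord0.
Qed.

Lemma hdiff_exact a b (c : bisimplex a.+1 b.+1 -> A) : chain_controlled c ->
  hdiff c = 0 -> exists2 c', chain_controlled c' & c = hdiff c'.
Proof.
move=> cc; have [psi psiP] := controlled_hcone cc.
pose v (x : simplex H b.+1) := psi x.2 => c0.
exists (push (hcone v) c); first exact: controlled_push.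
apply: alt_push_cone c0 => [i||[x y] _|i [x y] _].
- exact: proper_hface_on.
- exact: (@hcone_inj _ _ v).
- exact: (congr1 (pair^~ y) (sface0_cone (v y) x)).
exact: (congr1 (pair^~ y) (sfaceS_cone i (v y) x)).
Qed.

(** * Diagram chase between the two edges *)

Section Transfer.
Variable n : nat.
(** In degree n = 0 there is no cycle condition: group homology uses the unaugmented complex, and
    [vdiff] would lead into the corner (0, 0), where sums may be improper. *)
Hypothesis column_exact : forall c : bisimplex 0 n.+1 -> A, chain_controlled c ->
  ((0 < n)%N -> vdiff c = 0) -> exists2 c', chain_controlled c' & c = vdiff c'.

(** Induction along the diagonal a + b = n towards the column a = 0, where [column_exact] applies.
    Off the edge, hdiff d = vdiff d' with d' next on the diagonal; if d' = vdiff e + hdiff e'', then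
    d - vdiff e'' is killed by hdiff. *)
Lemma zigzag a b (d : bisimplex a.+1 b.+1 -> A) : (a + b = n)%N ->
  chain_controlled d -> ((0 < n)%N -> vdiff (hdiff d) = 0) ->
  exists e e', [/\ chain_controlled e, chain_controlled e' &
                   d = vdiff e + hdiff e'].
Proof.
elim: a b d => [|a IHa] b d abn cd d0.
  rewrite add0n in abn; subst b.
  have [c' cc' dE] := column_exact (controlled_hdiff cd) d0.
  have [e ce eE] := hdiff_surj cc'.
  have cve := controlled_vdiff ce.
  have [|e' ce' e'E] := hdiff_exact (controlledB cd cve).
    by rewrite hdiffB // hdiff_vdiff // -eE dE subrr.
  by exists e, e'; split=> //; rewrite -e'E addrC subrK.
have n_gt0 : (0 < n)%N by rewrite -abn.
have [d' cd' d'E] := vdiff_exact (controlled_hdiff cd) (d0 n_gt0).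
have [||e [e'' [ce ce'' eE]]] := IHa b.+1 d' _ cd'.
- by rewrite addnS.
- by move=> _; rewrite -hdiff_vdiff // -d'E hdiffK.
have cve'' := controlled_vdiff ce''.
have [|e' ce' e'E] := hdiff_exact (controlledB cd cve'').
  rewrite hdiffB // hdiff_vdiff // (_ : hdiff e'' = d' - vdiff e); last first.
    by rewrite eE addrC addKr.
  by rewrite vdiffB ?vdiffK ?d'E ?subr0 ?subrr //; apply: controlled_vdiff.
by exists e'', e'; split=> //; rewrite -e'E addrC subrK.
Qed.

(** Writing z = vdiff d and d = vdiff e + hdiff e' gives z = hdiff (vdiff e'). *)
Lemma row_exact (z : bisimplex n.+1 0 -> A) : chain_controlled z ->
  ((0 < n)%N -> hdiff z = 0) -> exists2 z', chain_controlled z' & z = hdiff z'.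
Proof.
move=> cz z0; have [d cd dE] := vdiff_surj cz.
have [||e [e' [ce ce' eE]]] := zigzag (b := 0) _ cd.
- by rewrite addn0.
- case: n z cz z0 d cd dE => [//|m] z cz z0 d cd dE _.
  by rewrite vdiff_hdiff // -dE z0.
exists (vdiff e'); first exact: controlled_vdiff.
rewrite dE -vdiff_hdiff // (_ : hdiff e' = d - vdiff e); last first.
  by rewrite eE addrC addKr.
by rewrite vdiffB ?vdiffK ?subr0 //; apply: controlled_vdiff.
Qed.

End Transfer.

End ControlledChains.

(** * Functions supported near an image *)

Section CoarseModule.
Variables (R : comNzRingType) (L K : groupType) (X : Type) (phi : X -> K).
Variable A : lmodType (group_ring R L).

Definition near_image (f : K -> A) : Prop :=
  exists2 F : set K, finite_set F &
    forall y, f y != 0 -> exists x, F (y * (phi x)^-1)%g.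

Definition near_pred : {pred K -> A} := fun f => `[< near_image f >].

Lemma near_zmod_closed : zmod_closed near_pred.
Proof.
split=> [|f g /asboolP[F fF Ff] /asboolP[E fE Eg]]; apply/asboolP.
  by exists set0; rewrite // => y; rewrite eqxx.
exists (F `|` E) => [|y]; first by rewrite finite_setU.
rewrite -[(f - g) y]/(f y - g y).
have [->|/Ff[x Fx] _] := eqVneq (f y) 0; last by exists x; left.
by rewrite sub0r oppr_eq0 => /Eg[x Ex]; exists x; right.
Qed.

HB.instance Definition _ :=
  GRing.isZmodClosed.Build _ near_pred near_zmod_closed.

Definition near_fun : Type := {f : K -> A | f \in near_pred}.
HB.instance Definition _ := SubChoice.on near_fun.
HB.instance Definition _ := [SubChoice_isSubZmodule of near_fun by <:].

Lemma near_translate r g (f : near_fun) :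
  (fun y => gmon r 1%g *: val f (g^-1 * y)%g) \in near_pred.
Proof.
have /asboolP[F fF Ff] := valP f; apply/asboolP.
exists [set (g * h)%g | h in F]; first exact: finite_image.
move=> y; have [->|/Ff[x Fx] _] := eqVneq (val f (g^-1 * y)%g) 0.
  by rewrite scaler0 eqxx.
by exists x; eexists; [exact: Fx|rewrite -mulgA mulVKg].
Qed.

Let act (r : R) (g : K) (f : near_fun) : near_fun :=
  exist (fun f => f \in near_pred) _ (near_translate r g f).

Let val_inj' (f f' : near_fun) : val f =1 val f' -> f = f'.
Proof. by move=> ff'; apply/val_inj/funext. Qed.

Lemma val_near_funB (f f' : near_fun) y : val (f - f') y = val f y - val f' y.
Proof. by rewrite (raddfB val). Qed.

Let actBl g f : zmod_morphism (fun r => act r g f).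
Proof.
by move=> r s; apply: val_inj' => y; rewrite val_near_funB /= gmonB scalerBl.
Qed.

Let actBr r g : zmod_morphism (act r g).
Proof.
by move=> f h; apply: val_inj' => y; rewrite !val_near_funB /= scalerBr.
Qed.

Let act11 f : act 1 1%g f = f.
Proof. by apply: val_inj' => y; rewrite /= gmon11 scale1r invg1 mul1g. Qed.

Let actM r s g h f : act r g (act s h f) = act (r * s) (g * h)%g f.
Proof.
apply: val_inj' => y.
by rewrite /= scalerA gmonM mulg1 invgM mulgA.
Qed.

Definition near_action : monomial_action R K near_fun :=
  MonomialAction actBl actBr act11 actM.

(** K translates the functions and R acts on their values. For phi the identity of K every function
    is near, and this is the coinduced module. *)
Definition near_module : lmodType (group_ring R K) := action_module near_action.

Lemma near_moduleE r g (f : near_module) y :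
  val (gmon r g *: f : near_fun) y = gmon r 1%g *: val (f : near_fun) (g^-1 * y)%g.
Proof. by rewrite [_ *: _](action_moduleE r g f). Qed.

(** The dictionary between chains with function coefficients and locally finite chains of
    simplices. *)
Definition chain_fun n (w : chain n near_module) : simplex K n.+1 -> A :=
  fun x => val (mcoeff x.1 w : near_fun) x.2.

Lemma chain_funB n : zmod_morphism (@chain_fun n).
Proof.
by move=> w w'; apply/funext => x; rewrite /chain_fun raddfB val_near_funB.
Qed.

HB.instance Definition _ n :=
  GRing.isZmodMorphism.Build _ _ (@chain_fun n) (@chain_funB n).

Lemma chain_fun_inj n : injective (@chain_fun n).
Proof.
move=> w w' ww'; apply/malgP => s; apply: val_inj' => y.
exact: (congr1 (fun f => f (s, y)) ww').
Qed.

Lemma chain_funU n (s t : n.-tuple K) (f : near_module) y :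
  chain_fun (mkmalgU s f) (t, y) = if s == t then val (f : near_fun) y else 0.
Proof.
by rewrite /chain_fun /= mcoeffU; case: (s == t); rewrite ?mulr1n // mulr0n.
Qed.

Lemma chain_fun_supp n (w : chain n near_module) x :
  chain_fun w x != 0 -> x.1 \in msupp w.
Proof.
by apply: contraNT => /mcoeff_outdom w0; rewrite /chain_fun w0 (raddf0 val).
Qed.

Lemma proper_sface n i (w : chain n.+1 near_module) :
  proper_on (@sface K n.+1 i) (chain_fun w).
Proof.
move=> t; pose v (s : n.+1.-tuple K) : simplex K n.+2 :=
  (s, if i == 0 then (thead s * t.2)%g else t.2).
apply: (sub_finite_set _ (finite_image v (finite_fset (msupp w)))).
move=> [s y] [st /chain_fun_supp ws]; exists s; rewrite // /v -st /=.
by congr (_, _); case: (i == 0%N) => //; rewrite mulVKg.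
Qed.

(** Face 0 replaces the first vertex y by g^-1 y, g the first label, so the summed function at y is
    f(g y): this is the action of g^-1 in [boundary]. *)
Lemma chain_fun_boundary n (w : chain n.+1 near_module) :
  chain_fun (boundary w) = alt_push n.+2 (@sface K n.+1) (chain_fun w).
Proof.
move: w; apply: malg_morphism_eq => [w w'|w w'|s f].
- by rewrite !raddfB.
- by rewrite raddfB alt_pushB // => i; apply: proper_sface.
have pushU (i : nat) t y : push (@sface K n.+1 i) (chain_fun (mkmalgU s f)) (t, y) =
    if face i s == t then val f (if i == 0 then thead s * y else y)%g else 0.
  pose y' := (if i == 0 then thead s * y else y)%g.
  rewrite (pushE (X := [fset ((s, y') : simplex K n.+2)]%fset)); last first.
    move=> [s' x] /= [_ xy] /chain_fun_supp; rewrite msuppU.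
    case: ifP => // _; rewrite inE => /eqP /= s's; rewrite inE /y' -xy s's.
    apply/eqP; congr (_, _).
    by case: (i == 0%N) => //=; rewrite mulVKg.
  rewrite big_mkcond big_seq_fset1 /= xpair_eqE /chain_fun /= mcoeffUU.
  rewrite (_ : (if i == 0 then _ else y') = y) ?eqxx ?andbT // /y'.
  by case: (i == 0%N) => //; rewrite mulKg.
apply/funext => -[t y]; rewrite boundaryU raddfD.
rewrite -[LHS]/(chain_fun _ (t, y) + chain_fun _ (t, y)).
rewrite [RHS]big_ord_recl [in RHS]pushU expr0 mulr1z; congr (_ + _).
  by rewrite chain_funU; case: ifP => // _; rewrite near_moduleE gmon11 scale1r invgK.
rewrite (big_morph (fun w : chain n near_module => chain_fun w (t, y))
  (id1 := 0) (op1 := +%R)) => [|w w'|]; last by rewrite raddf0.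
  apply: eq_bigr => i _; rewrite pushU chain_funU scale_sign.
  by case: ifP => _; rewrite ?mul0rz // -signr_odd; case: (odd _);
    rewrite ?mulrN1z ?(raddfN val).
by rewrite raddfD.
Qed.

End CoarseModule.

Lemma chain_fun_lift (R : comNzRingType) (L K : groupType) (X : Type)
    (phi : X -> K) (A : lmodType (group_ring R L)) n (c : simplex K n.+1 -> A)
    (T : set (n.-tuple K)) :
  finite_set T -> (forall x, c x != 0 -> T x.1) ->
  (forall s, near_image phi (fun y => c (s, y))) ->
  exists w : chain n (near_module phi A), chain_fun w = c.
Proof.
move=> fT cT cn; have cnP s : (fun y => c (s, y)) \in near_pred (A := A) phi.
  exact/asboolP.
pose f s : near_module phi A := exist (fun f => f \in near_pred (A := A) phi) _ (cnP s).
exists (\sum_(s <- fset_set T) mkmalgU s (f s)).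
apply/funext => -[t y].
rewrite (big_morph (fun w : chain n (near_module phi A) => chain_fun w (t, y))
  (id1 := 0) (op1 := +%R)) => [|w w'|]; [|by rewrite raddfD|by rewrite raddf0].
under eq_bigr => s _ do rewrite chain_funU.
have [/negbTE tT|tT] := boolP (t \notin fset_set T).
  rewrite big1_seq => [|s /= sT]; last first.
    by case: eqP => // st; rewrite -st sT in tT.
  apply/esym/eqP; apply: contraFT tT => ct; apply: (mem_fset_set fT).
  exact: cT ct.
rewrite (bigD1_seq t) ?fset_uniq //=; last by rewrite negbK in tT.
by rewrite eqxx big1 ?addr0 // => s /negbTE ->.
Qed.

Lemma chain_fun_near (R : comNzRingType) (L K : groupType) (X : Type)
    (phi : X -> K) (A : lmodType (group_ring R L)) n
    (w : chain n (near_module phi A)) :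
  exists2 F : set K, finite_set F &
    forall x, chain_fun w x != 0 -> exists g, F (x.2 * (phi g)^-1)%g.
Proof.
have /choice[F FP] s : exists F : set K, finite_set F /\
    forall y, chain_fun w (s, y) != 0 -> exists g, F (y * (phi g)^-1)%g.
  by have /asboolP[F fF FP] := valP (mcoeff s w : near_fun phi A); exists F.
exists (\bigcup_(s in [set` msupp w]) F s).
  by apply: bigcup_finite => [|s _]; [exact: finite_fset|have [] := FP s].
move=> [s y] ws; have [_ /(_ y ws)[g Fg]] := FP s.
by exists g, s => //; apply: chain_fun_supp ws.
Qed.

(** * Transfer of vanishing from H to G *)

Section CoarseInvariance.
Variables (R : comNzRingType) (G H : groupType) (phi : G -> H).
Variable A : lmodType (group_ring R G).
Hypothesis phi_emb : coarse_embedding phi.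

Let row a (x : simplex G a) : bisimplex G H a 0 := (x, tt).
Let col b (y : simplex H b) : bisimplex G H 0 b := (tt, y).

Let row_inj a : injective (@row a). Proof. by move=> x y []. Qed.
Let col_inj b : injective (@col b). Proof. by move=> x y []. Qed.

Let pushK (S T : choiceType) (p : S -> T) : injective p ->
  injective (push p : (S -> A) -> T -> A).
Proof.
by move=> pI c d cd; apply/funext => s; rewrite -!(push_inj _ _ pI) cd.
Qed.

Let rowK a (c : bisimplex G H a 0 -> A) : c = push (@row a) (c \o @row a).
Proof.
by apply/funext => -[x []]; rewrite -[(x, tt)]/(row x) push_inj.
Qed.

Let colK b (c : bisimplex G H 0 b -> A) : c = push (@col b) (c \o @col b).
Proof.
by apply/funext => -[[] x]; rewrite -[(tt, x)]/(col x) push_inj.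
Qed.

Let hdiff_row n (w : chain n.+1 (near_module (id : G -> G) A)) :
  hdiff (push (@row n.+2) (chain_fun w)) = push (@row n.+1) (chain_fun (boundary w)).
Proof.
rewrite chain_fun_boundary; apply: alt_push_transport => // i.
exact: proper_sface.
Qed.

Let vdiff_col n (w : chain n.+1 (near_module phi A)) :
  vdiff (push (@col n.+2) (chain_fun w)) = push (@col n.+1) (chain_fun (boundary w)).
Proof.
rewrite chain_fun_boundary; apply: alt_push_transport => // i.
exact: proper_sface.
Qed.

Let controlled_row n (w : chain n (near_module (id : G -> G) A)) :
  chain_controlled phi (push (@row n.+1) (chain_fun w)).
Proof.
apply: controlled_push; exists [set` msupp w], setT, set0.
have fT : finite_set [set: unit].
  by apply: (sub_finite_set _ (finite_set1 tt)) => -[].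
split; [exact: (finite_fset (msupp w))|exact: fT|exact: finite_set0|].
by move=> _ [x /chain_fun_supp wx <-].
Qed.

Let controlled_col n (w : chain n (near_module phi A)) :
  chain_controlled phi (push (@col n.+1) (chain_fun w)).
Proof.
have [F fF FP] := chain_fun_near w.
apply: controlled_push; exists setT, [set` msupp w], F.
have fT : finite_set [set: unit].
  by apply: (sub_finite_set _ (finite_set1 tt)) => -[].
split; [exact: fT|exact: (finite_fset (msupp w))|exact: fF|].
move=> _ [x wx <-]; split=> //; first exact: chain_fun_supp wx.
by move=> _ [<-]; have [g Fg] := FP x wx; exists g.
Qed.

Let row_lift n (c : bisimplex G H n.+1 0 -> A) : chain_controlled phi c ->
  exists w : chain n (near_module (id : G -> G) A),
    c = push (@row n.+1) (chain_fun w).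
Proof.
move=> [T1 [T2 [F [fT1 _ _ cP]]]].
have [|x /cP[]//|s|w wE] := @chain_fun_lift R G G G id A n (c \o @row n.+1) T1.
- by [].
- exists [set 1%g] => [|y _]; first exact: finite_set1.
  by exists y; rewrite /= mulgV.
by exists w; rewrite wE -rowK.
Qed.

Let col_lift n (c : bisimplex G H 0 n.+1 -> A) : chain_controlled phi c ->
  exists w : chain n (near_module phi A), c = push (@col n.+1) (chain_fun w).
Proof.
move=> [T1 [T2 [F [_ fT2 fF cP]]]].
have [|x /cP[]//|s|w wE] := @chain_fun_lift R G H G phi A n (c \o @col n.+1) T2.
- by [].
- exists F => // y /cP[_ _ /(_ y erefl)[g [_ gF]]].
  by exists g.
by exists w; rewrite wE -colK.
Qed.

Lemma homology_vanish_near n : homology_vanish (near_module phi A) n ->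
  homology_vanish (near_module (id : G -> G) A) n.
Proof.
move=> vH v v0.
have col_exact (c : bisimplex G H 0 n.+1 -> A) : chain_controlled phi c ->
    ((0 < n)%N -> vdiff c = 0) ->
    exists2 c', chain_controlled phi c' & c = vdiff c'.
  move=> /col_lift[w cE]; subst c => w0; have [|w' ->] := vH w.
    case: n w w0 {vH v v0} => [//|n] w /(_ isT); rewrite vdiff_col => w0 /=.
    apply: chain_fun_inj; apply: (pushK (@col_inj _)).
    by rewrite w0 raddf0; apply/esym/funext => x; apply: big1.
  exists (push (@col n.+2) (chain_fun w')); first exact: controlled_col.
  by rewrite vdiff_col.
have [|z' /row_lift[w ->] vE] := row_exact phi_emb col_exact (controlled_row v).
  case: n v v0 {vH col_exact} => [//|n] v /= v0 _.
  rewrite hdiff_row v0 raddf0; apply/funext => x; exact: big1.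
exists w; apply: chain_fun_inj; apply: (pushK (@row_inj _)).
by rewrite vE hdiff_row.
Qed.

End CoarseInvariance.

(** * Dimensions *)

Section RegularEmbedding.
Variables (R : comNzRingType) (G : groupType).
Local Notation RG := (group_ring R G).
Variable A : lmodType RG.
Local Notation M := (near_module (id : G -> G) A).

Let near_all (f : G -> A) : f \in near_pred (A := A) (id : G -> G).
Proof.
apply/asboolP; exists [set 1%g] => [|y _]; first exact: finite_set1.
by exists y; rewrite /= mulgV.
Qed.

(** The inverse makes this equivariant for translation of functions: (g a)(x) = x^-1 g a = (g^-1
    x)^-1 a. *)
Definition orbit_map (a : A) : M :=
  exist (fun f => f \in near_pred (A := A) (id : G -> G)) _
    (near_all (fun x => gmon 1 x^-1%g *: a)).

Lemma orbit_mapE a x : val (orbit_map a : near_fun id A) x = gmon 1 x^-1%g *: a.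
Proof. by []. Qed.

Lemma orbit_mapB : zmod_morphism orbit_map.
Proof.
move=> a b; apply/val_inj/funext => x.
by rewrite val_near_funB !orbit_mapE scalerBr.
Qed.

Lemma orbit_mapZ r : {morph orbit_map : a / r *: a}.
Proof.
move=> a; move: r; apply: group_ring_morphism_eq => [r s|r s|r g].
- by rewrite scalerBl orbit_mapB.
- by rewrite scalerBl.
apply/val_inj/funext => x; rewrite near_moduleE !orbit_mapE !scalerA !gmonM.
by rewrite mul1r mulr1 mul1g invgM invgK.
Qed.

HB.instance Definition _ :=
  GRing.isZmodMorphism.Build A M orbit_map orbit_mapB.
HB.instance Definition _ :=
  GRing.isScalable.Build RG A M *:%R orbit_map orbit_mapZ.

Lemma orbit_map_inj : injective orbit_map.
Proof.
move=> a b /(congr1 (fun f : near_fun id A => val f 1%g)).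
by rewrite !orbit_mapE invg1 !scale1r.
Qed.

End RegularEmbedding.

(** One step of a descending induction on the degree: all modules in degree n + 1, and the near
    functions on H in degree n, give all modules in degree n. *)
Lemma homology_vanish_coarse (R : comNzRingType) (G H : groupType)
    (phi : G -> H) n :
  coarse_embedding phi ->
  (forall W : lmodType (group_ring R G), homology_vanish W n.+1) ->
  (forall A : lmodType (group_ring R G), homology_vanish (near_module phi A) n) ->
  forall A : lmodType (group_ring R G), homology_vanish A n.
Proof.
move=> phi_emb HW HB A.
apply: (@homology_vanish_sub _ _ _ _ (@orbit_map R G A)) => //.
  exact: orbit_map_inj.
exact: (homology_vanish_near phi_emb).
Qed.

Section Dimension.
Implicit Types N : set nat.
Local Notation "'sup' N" := (supremum -oo%E [set (n%:Z)%:E | n in N])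
  (at level 10).

Let supE N x : N !=set0 -> supremums [set (n%:Z)%:E | n in N] x -> sup N = x.
Proof.
move=> [n Nn] Sx; rewrite /supremum ifF.
  exact: (xget_subset1 _ Sx (@is_subset1_supremums _ _ _)).
apply/negbTE/eqP => N0.
have : [set (n%:Z)%:E | n in N] (n%:Z)%:E by exists n.
by rewrite N0.
Qed.

(** [supremum] selects a least upper bound by choice; later estimates of [hd] and [cd] go through
    these cases. *)
Lemma supremum_int_cases N :
  [\/ N = set0 /\ sup N = -oo%E,
      exists m, [/\ N m, forall k, N k -> (k <= m)%N & sup N = (m%:Z)%:E]
    | (forall b, exists2 k, N k & (b < k)%N) /\ sup N = +oo%E].
Proof.
have [->|/set0P N0] := eqVneq N set0.
  by apply: Or31; rewrite image_set0 supremum0.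
have [[b Nb]|unb] := pselect (exists b, forall k, N k -> (k <= b)%N).
  apply: Or32; have exN : exists n, `[< N n >].
    by have [n Nn] := N0; exists n; apply/asboolP.
  have bN n : `[< N n >] -> (n <= b)%N by move/asboolP/Nb.
  have [m /asboolP Nm mP] := ex_maxnP exN bN.
  have Nle k : N k -> (k <= m)%N by move=> Nk; apply/mP/asboolP.
  exists m; split=> //; apply: (@supE _ _ N0); split.
    by move=> _ [k /Nle km <-]; rewrite lee_fin lez_nat.
  by move=> y; apply; exists m.
apply: Or33; split=> [b|].
  apply: contra_notP unb => Nb; exists b => k Nk; rewrite leqNgt.
  by apply/negP => bk; apply: Nb; exists k.
apply: (@supE _ _ N0); split; first by move=> y _; apply: leey.
move=> [r||] // yub; last first.
  by have [n Nn] := N0; have := yub (n%:Z)%:E (ex_intro2 _ _ _ Nn erefl).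
case: unb; exists `|r|%N => k Nk.
have := yub (k%:Z)%:E (ex_intro2 _ _ _ Nk erefl); rewrite lee_fin => kr.
by rewrite -lez_nat (le_trans kr) // lez_abs.
Qed.

Lemma supremum_int_ub N n : N n -> ((n%:Z)%:E <= sup N)%E.
Proof.
move=> Nn; have [[N0]|[m [_ /(_ n Nn) nm ->]]|[_ ->]] := supremum_int_cases N.
- by rewrite N0 in Nn.
- by rewrite lee_fin lez_nat.
exact: leey.
Qed.

Lemma supremum_int_lt N n : (forall k, N k -> (k < n)%N) -> (sup N < (n%:Z)%:E)%E.
Proof.
move=> Nn; have [[_ ->]|[m [/Nn mn _ ->]]|[unb _]] := supremum_int_cases N.
- exact: ltNyr.
- by rewrite lte_fin ltz_nat.
by have [k /Nn kn /(ltn_trans kn)] := unb n; rewrite ltnn.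
Qed.

End Dimension.

Section Degrees.
Variables (R : comNzRingType) (G : groupType).
Local Notation RG := (group_ring R G).

Lemma hd_degreeP n :
  (exists (A : lmodType RG) (x : group_homology A n), x != 0) <->
  ~ forall A : lmodType RG, homology_vanish A n.
Proof.
split=> [[A [x /eqP x0]] /(_ A)/homology_vanishP xP|]; first exact/x0/xP.
apply: contra_notP => nex A; apply/homology_vanishP => x.
by apply/eqP; apply: contra_notT nex => x0; exists A, x.
Qed.

Lemma cd_degreeP n :
  (exists (A : lmodType RG) (x : group_cohomology A n), x != 0) <->
  ~ forall A : lmodType RG, cohomology_vanish A n.
Proof.
split=> [[A [x /eqP x0]] /(_ A)/cohomology_vanishP xP|]; first exact/x0/xP.
apply: contra_notP => nex A; apply/cohomology_vanishP => x.
by apply/eqP; apply: contra_notT nex => x0; exists A, x.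
Qed.

Lemma hd_lt n : (forall A : lmodType RG, forall m, (n <= m)%N -> homology_vanish A m) ->
  (hd R G < (n%:Z)%:E)%E.
Proof.
move=> HA; apply: supremum_int_lt => k /hd_degreeP nk.
by rewrite ltnNge; apply/negP => nk'; apply: nk => A; apply: HA.
Qed.

Lemma cd_lt n : (forall A : lmodType RG, forall m, (n <= m)%N -> cohomology_vanish A m) ->
  (cd R G < (n%:Z)%:E)%E.
Proof.
move=> HA; apply: supremum_int_lt => k /cd_degreeP nk.
by rewrite ltnNge; apply/negP => nk'; apply: nk => A; apply: HA.
Qed.

Lemma le_cd n : (~ forall A : lmodType RG, cohomology_vanish A n) ->
  ((n%:Z)%:E <= cd R G)%E.
Proof. by move=> /cd_degreeP nn; apply: supremum_int_ub. Qed.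

(** Finiteness of [hd] gives a greatest degree with nonzero homology, if there is one at all; were
    it at least n, the descent step would make it vanish. *)
Lemma hd_descent n :
  (forall m, (n <= m)%N -> (forall A : lmodType RG, homology_vanish A m.+1) ->
    forall A : lmodType RG, homology_vanish A m) ->
  (hd R G < +oo)%E ->
  forall m, (n <= m)%N -> forall A : lmodType RG, homology_vanish A m.
Proof.
move=> desc; rewrite /hd; move: (supremum_int_cases [set n | 
  exists (A : lmodType RG) (x : group_homology A n), x != 0]).
have cl m : ~ [set n | exists (A : lmodType RG) (x : group_homology A n), x != 0] m ->
    forall A : lmodType RG, homology_vanish A m.
  by move=> nm; apply: contra_notP nm => /hd_degreeP.
case=> [[N0 _] _|[m [Nm mP _] _]|[_ ->]]; last by rewrite ltxx.
  by move=> k _; apply: cl; rewrite N0.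
have above k : (m < k)%N -> forall A : lmodType RG, homology_vanish A k.
  by move=> mk; apply: cl => /mP; rewrite leqNgt mk.
move=> k nk; have [/above//|km] := ltnP m k.
have [] := (hd_degreeP m).1 Nm; apply: desc; first exact: leq_trans km.
exact/above.
Qed.

(** With trivial action the two faces of a 1-simplex cancel, so 1 is no boundary. *)
Lemma homology0_trivial : ~ homology_vanish (trivial_module R G) 0.
Proof.
move=> /(_ (mkmalgU [tuple] (1 : R)) erefl)[y yE].
have y0 : mcoeff [tuple] (boundary y) = 0.
  move: y {yE}; apply: (malg_morphism_eq
    (f := fun y : chain 1 (trivial_module R G) => mcoeff [tuple] (boundary y))
    (g := \0)) => [x y|x y|s a].
  - by rewrite boundaryB mcoeffB.
  - by rewrite subrr.
  rewrite boundaryU big_ord1 mcoeffD [face 0 s]tuple0 [face 1 s]tuple0.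
  rewrite !mcoeffUU scaleN1r action_moduleE.
  by rewrite [trivial_action _ _ _ _ _]mul1r subrr.
by have := oner_neq0 R; rewrite -y0 -yE mcoeffUU eqxx.
Qed.

Lemma cohomology0_trivial : ~ cohomology_vanish (trivial_module R G) 0.
Proof.
pose c : cochain 0 (trivial_module R G) := fun=> (1 : R).
move=> /(_ c)[|c' cE].
  apply/funext => s; rewrite /coboundary big_ord_recl big_ord1 expr0 scale1r.
  rewrite expr1 scaleN1r action_moduleE.
  by rewrite [trivial_action _ _ _ _ _]mul1r subrr.
have : c [tuple] = 0 by rewrite cE.
by move/eqP; rewrite (oner_eq0 R).
Qed.

End Degrees.

(** * Poincare duality *)

Section Twist.
Variables (R : comNzRingType) (H : groupType).
Local Notation RH := (group_ring R H).
Variable C : lmodType RH^c.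
Variables (e : R -> C) (e' : C -> R).
Hypothesis eB : zmod_morphism e.
Hypotheses (eK : cancel e e') (e'K : cancel e' e).
Hypothesis eM : forall r s, e (r * s) = ract (e s) (gmon r 1%g).

(** The orientation character: e(1) g = e(u(g)). *)
Definition orientation (g : H) : R := e' (ract (e 1) (gmon 1 g)).
Local Notation u := orientation.

Lemma ract_e s r g : ract (e s) (gmon r g) = e (s * r * u g).
Proof.
rewrite -{1}[s]mulr1 eM ractM gmonM mul1g mulrC.
rewrite [RHS]eM e'K ractM gmonM mul1r mulg1.
by [].
Qed.

Lemma orientation1 : u 1%g = 1.
Proof. by rewrite /u gmon11 [ract _ _]scale1r eK. Qed.

Lemma orientationM g h : u (g * h)%g = u g * u h.
Proof.
apply: (can_inj eK); rewrite -[u g]mulr1 -ract_e {1}/u e'K {1}/u e'K ractM gmonM.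
by rewrite mulr1.
Qed.

Section Module.
Variable B : lmodType RH.

Let act (r : R) (g : H) (b : B) : B := gmon (u g * r) g *: b.

Let actBl g b : zmod_morphism (fun r => act r g b).
Proof. by move=> r s; rewrite /act mulrBr gmonB scalerBl. Qed.

Let actBr r g : zmod_morphism (act r g).
Proof. by move=> a b; rewrite /act scalerBr. Qed.

Let act11 b : act 1 1%g b = b.
Proof. by rewrite /act orientation1 mulr1 gmon11 scale1r. Qed.

Let actM r s g h b : act r g (act s h b) = act (r * s) (g * h)%g b.
Proof. by rewrite /act scalerA gmonM orientationM mulrACA. Qed.

Definition twist_action : monomial_action R H B :=
  MonomialAction actBl actBr act11 actM.

(** On the tensor product with C, g acts through u(g)^-1 on the left factor. The twist by u
    compensates this, so that duality reaches the homology with coefficients in [B] itself. *)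
Definition twist : lmodType RH := action_module twist_action.

Lemma twistE r g (b : twist) : gmon r g *: b = gmon (u g * r) g *: (b : B) :> B.
Proof. exact: action_moduleE. Qed.

Definition untwist (b : B) : tensor_module C twist := tensor (e 1) (b : twist).

Lemma untwistB : zmod_morphism untwist.
Proof. by move=> a b; apply: (@tensorBr R H C twist (e 1) a b). Qed.

Lemma untwistZ x : {morph untwist : b / x *: b}.
Proof.
move=> b; move: x; apply: group_ring_morphism_eq => [x y|x y|r g].
- by rewrite scalerBl untwistB.
- by rewrite scalerBl.
rewrite [RHS]tensor_moduleE ract_e !mul1r -[u _]mulr1 eM tensor_bal.
rewrite !twistE scalerA gmonM mul1g orientation1 !mul1r mulrA -orientationM.
by rewrite mulVg orientation1 mul1r.
Qed.

HB.instance Definition _ :=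
  GRing.isZmodMorphism.Build B (tensor_module C twist) untwist untwistB.
HB.instance Definition _ :=
  GRing.isScalable.Build RH B (tensor_module C twist) *:%R untwist untwistZ.

Let contract (x : malg (C * twist)%type int) : B :=
  malg_ext (fun (ca : C * twist) (k : int) =>
    (gmon (e' ca.1) 1%g *: (ca.2 : B)) *~ k) x.

Let contractB : zmod_morphism contract.
Proof. by apply: malg_ext_is_zmod_morphism => ca k l; rewrite mulrzBr. Qed.

Let contractU c a : contract (mkmalgU (c, a) 1) = gmon (e' c) 1%g *: (a : B).
Proof.
by rewrite /contract malg_extU ?mulr1z // => ca k l; rewrite mulrzBr.
Qed.

Let e'D : {morph e' : x y / x + y}.
Proof.
by move=> x y; apply: (can_inj eK); rewrite (zmod_morphismD eB) !e'K.
Qed.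

Let contract_rel x : tensor_rel x -> contract x = 0.
Proof.
have e'Z c r : e' (ract c (gmon r 1%g)) = e' c * r.
  by apply: (can_inj eK); rewrite e'K mulrC eM e'K.
elim=> [|{}x y _ IHx _ IHy|c c' a|c a a'|r c a].
- by rewrite -(subrr 0) contractB subrr.
- by rewrite contractB IHx IHy subrr.
- rewrite !contractB !contractU e'D -[gmon (_ + _) _]/(mkmalgU _ _) monalgUD.
  by rewrite scalerDl -addrA -opprD subrr.
- by rewrite !contractB !contractU scalerDr -addrA -opprD subrr.
rewrite contractB; apply/eqP; rewrite subr_eq0; apply/eqP.
rewrite [LHS]contractU [RHS]contractU (twistE r 1%g a) orientation1 mul1r.
by rewrite scalerA gmonM mulg1 e'Z.
Qed.

(** Every c (x) a equals e(1) (x) e'(c) a, so the inverse is c (x) a |-> e'(c) a. *)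
Lemma untwist_bij : bijective untwist.
Proof.
pose g (x : tensor_module C twist) : B := contract (repr (x : tensor_group C twist)).
have gE c a : g (tensor c a) = gmon (e' c) 1%g *: (a : B).
  rewrite -contractU; apply/eqP; rewrite -subr_eq0 -contractB; apply/eqP.
  by apply: contract_rel; apply/tensor_class_eq; rewrite tensor_class_repr.
have gB : zmod_morphism g.
  move=> x y; apply/eqP; rewrite -subr_eq0 -!contractB; apply/eqP.
  apply: contract_rel; apply/tensor_class_eq.
  by rewrite tensor_classB !tensor_class_repr.
exists g => [b|]; first by rewrite gE eK gmon11 scale1r.
apply: (@tensor_morphism_eq R H C twist _ (fun x => untwist (g x)) idfun) => //.
  by move=> x y; rewrite gB untwistB.
move=> c a; rewrite gE /=.
have -> : tensor c a = tensor (e 1) (gmon (e' c) 1%g *: a).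
  by rewrite -tensor_bal -eM mulr1 e'K.
by rewrite (twistE (e' c) 1%g a) orientation1 mul1r.
Qed.

End Module.
End Twist.

Section PoincareDuality.
Variables (R : comNzRingType) (H : groupType).
Local Notation RH := (group_ring R H).

(** Above n the dual group sits in negative degree; in degree n duality leads to degree 0, where
    homology and cohomology are explicit. *)
Lemma pd_dimension : poincare_duality_group R H ->
  exists (n : nat) (u : H -> R),
  [/\ forall (B : lmodType RH) m, (n < m)%N -> homology_vanish B m,
      forall (B : lmodType RH) m, (n < m)%N -> cohomology_vanish B m,
      ~ forall B : lmodType RH, cohomology_vanish B n,
      ~ forall B : lmodType RH, homology_vanish B n
    & forall B : lmodType RH,
        (forall b : B, (forall g, gmon (u g) g *: b = b) -> b = 0) ->
        homology_vanish B n].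
Proof.
move=> [C [n [[e [eB [e' eK e'K] eM]] [Phi [PhiB _]]]]].
have vanishP k A : (forall x : group_cohomologyz A k, x = 0) <->
    (forall x : group_homologyz (tensor_module C A) (n%:Z - k), x = 0).
  have [Psi PhiK PsiK] := PhiB k A.
  split=> x0 x; last by apply: (can_inj PhiK); rewrite (x0 (Phi k A x)) raddf0.
  by rewrite -(PsiK x) (x0 (Psi x)) raddf0.
have homz (B : lmodType RH) k m : k = m%:Z ->
    (forall x : group_homologyz B k, x = 0) <-> homology_vanish B m.
  by move=> ->; rewrite homology_vanishP.
have cohz (B : lmodType RH) k m : k = m%:Z ->
    (forall x : group_cohomologyz B k, x = 0) <-> cohomology_vanish B m.
  by move=> ->; rewrite cohomology_vanishP.
have zmod0_eq (x : zmod0) : x = 0 by apply/matrixP => i [].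
have hom_neg (B : lmodType RH) k : k < 0 -> forall x : group_homologyz B k, x = 0.
  by case: k => // k _ x; apply: zmod0_eq.
have coh_neg (B : lmodType RH) k : k < 0 -> forall x : group_cohomologyz B k, x = 0.
  by case: k => // k _ x; apply: zmod0_eq.
have nmK m : n%:Z - (n%:Z - m%:Z) = m%:Z by rewrite opprB addrC subrK.
have nm_lt m : (n < m)%N -> n%:Z - m%:Z < 0 by rewrite subr_lt0 ltz_nat.
pose D B := twist eK e'K eM B.
have DB B m : homology_vanish (tensor_module C (D B)) m -> homology_vanish B m.
  exact: homology_vanish_bij (untwist_bij eB eK e'K eM B).
exists n, (orientation e e'); split=> [B m nm|B m nm|cn|hn|B b0].
- by apply: DB; apply/(homz _ _ _ (nmK m))/vanishP/coh_neg/nm_lt.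
- by apply/(cohz _ m%:Z)/vanishP => //; apply/hom_neg/nm_lt.
(* H^n(H, -) on the twist of the trivial module is H_0(H, R), which is nonzero. *)
- apply: (@homology0_trivial R H); apply: DB.
  apply/(homz _ (n%:Z - n%:Z)); first by rewrite subrr.
  exact/vanishP/(cohz _ n%:Z _ erefl)/cn.
- apply: (@cohomology0_trivial R H); apply/(cohz _ 0 0%N erefl)/vanishP.
  by apply/(homz _ _ n); [rewrite subr0|apply: hn].
(* H_n(H, B) is H^0 of the twist of B, that is, the b with u(g) g b = b for all g. *)
apply: DB; apply/(homz _ (n%:Z - 0)); first by rewrite subr0.
apply/vanishP/(cohz _ 0 0%N erefl) => c c0; exists 0.
apply/funext => s; rewrite [s]tuple0 /=; apply: b0 => g.
have : coboundary c [tuple g] = 0 by rewrite c0.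
rewrite /coboundary big_ord_recl big_ord1 expr0 scale1r expr1 scaleN1r.
rewrite [face _ _]tuple0 [face (lift _ _) _]tuple0 => /eqP.
rewrite subr_eq0 => /eqP gc.
rewrite -[RHS]gc /= theadE.
by rewrite twistE mulr1.
Qed.

End PoincareDuality.

Section CoarselySurjective.
Variables (G H : groupType) (phi : G -> H).
Hypothesis phi_emb : coarse_embedding phi.

Lemma coarse_embedding_map : coarse_map phi.
Proof.
split=> [h|S]; first exact: finite_fibre_phi.
by move/phi_emb.
Qed.

Lemma coarse_embedding_equivalence (F : set H) : finite_set F ->
  (forall y, exists x, F (y * (phi x)^-1)%g) -> coarse_equivalence phi.
Proof.
move=> fF /choice[psi psiF]; split; first exact: coarse_embedding_map.
have phi_map := coarse_embedding_map.
exists psi; split.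
- split=> [g|S fS].
    apply: (sub_finite_set _ (finite_image (fun f => f * phi g)%g fF)).
    by move=> y <-; exists (y * (phi (psi y))^-1)%g => //; rewrite mulgVK.
  (* With f_i = p_i phi(psi(p_i))^-1 in F, the quotient phi(psi(p_1)) phi(psi(p_2))^-1 is f_1^-1
     (p_1 p_2^-1) f_2, an element of [E']; the embedding property pulls it back to G. *)
  pose E := [set (f^-1 * k)%g | f in F & k in [set (p.1 * p.2^-1)%g | p in S]].
  pose E' := [set (k * f)%g | k in E & f in F].
  have fE' : finite_set E' by do 2 apply: finite_image2 => //.
  apply: (sub_finite_set _ (controlled_preimage_phi phi_emb fE')).
  move=> _ [p Sp <-]; exists (psi p.1, psi p.2) => //=.
  exists ((p.1 * (phi (psi p.1))^-1)^-1 * (p.1 * p.2^-1))%g.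
    exists (p.1 * (phi (psi p.1))^-1)%g; first exact: psiF.
    by exists (p.1 * p.2^-1)%g => //; exists p.
  exists (p.2 * (phi (psi p.2))^-1)%g; first exact: psiF.
  by rewrite invgM invgK !mulgA !mulgVK.
- apply: (sub_finite_set _ (controlled_preimage_phi phi_emb
    (finite_image (fun f => f^-1)%g fF))).
  move=> _ [x _ <-]; exists (psi (phi x), x) => //=.
  by eexists; first exact: (psiF (phi x)); rewrite invgM invgK.
apply: (sub_finite_set _ (finite_image (fun f => f^-1)%g fF)).
move=> _ [y _ <-]; eexists; first exact: (psiF y).
by rewrite invgM invgK.
Qed.

End CoarselySurjective.

Lemma homology_vanish_near_top (R : comNzRingType) (G H : groupType)
    (phi : G -> H) (A : lmodType (group_ring R G)) (u : H -> R) n :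
  coarse_embedding phi -> ~ coarse_equivalence phi ->
  (forall B : lmodType (group_ring R H),
     (forall b : B, (forall g, gmon (u g) g *: b = b) -> b = 0) ->
     homology_vanish B n) ->
  homology_vanish (near_module phi A) n.
Proof.
move=> phi_emb phi_neq; apply=> b bg; apply: contra_notP phi_neq => b0.
have /asboolP[F fF FP] := valP (b : near_fun phi A).
apply: (coarse_embedding_equivalence phi_emb fF) => y; apply: FP.
have [y0 by0] : exists y0, val (b : near_fun phi A) y0 != 0.
  apply: contra_notP b0 => nex; apply/val_inj/funext => x.
  by apply/eqP; apply: contra_notT nex => bx; exists x.
(* For g = y0 y^-1, invariance at y0 reads u(g) b(y) = b(y0), so b(y) is nonzero. *)
have := congr1 (fun f : near_fun phi A => val f y0) (bg (y0 * y^-1)%g).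
rewrite near_moduleE invgM invgK mulgVK => yE.
by apply: contra_neq by0 => y0E; rewrite -yE y0E scaler0.
Qed.

Theorem corollary4p49 (R : comNzRingType) (H : groupType)
    (countableH : countable [set: H]) (pdH : poincare_duality_group R H) :
  (forall (G : groupType) (phi : G -> H),
     countable [set: G] ->
     coarse_embedding phi -> ~ coarse_equivalence phi ->
     (hd R G < +oo)%E ->
     (hd R G < cd R H)%E /\
     (type_FP_infty R G -> (cd R G < cd R H)%E)) /\
  (forall phi : H -> H, coarse_embedding phi -> coarse_equivalence phi).
Proof.
have [n [u [hgt cgt cn hn htop]]] := pd_dimension pdH.
have le_n : ((n%:Z)%:E <= cd R H)%E by apply: le_cd.
have vanish (G : groupType) (phi : G -> H) : coarse_embedding phi ->
    ~ coarse_equivalence phi -> (hd R G < +oo)%E ->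
    forall m, (n <= m)%N -> forall A : lmodType (group_ring R G),
    homology_vanish A m.
  move=> phi_emb phi_neq; apply: hd_descent => m nm Hm.
  apply: (homology_vanish_coarse phi_emb Hm) => A.
  move: nm; rewrite leq_eqVlt => /predU1P[<-|nm]; last exact: hgt.
  exact: homology_vanish_near_top phi_emb phi_neq htop.
split=> [G phi _ phi_emb phi_neq hdG|phi phi_emb]; last first.
  (* A self embedding that is no equivalence would make H_n(H, -) vanish; hd H is finite because
     homology of H vanishes above n. *)
  apply: contrapT => phi_neq; apply: hn; apply: (vanish H phi) => //.
  apply: (@lt_trans _ _ (n.+1%:Z)%:E); last exact: ltry.
  by apply: hd_lt => A m; apply: hgt.
have Gvan := vanish G phi phi_emb phi_neq hdG.
(* The passage from homology to cohomology works in positive degrees only; n = 0 would contradict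
   H_0(G, R) = R. *)
have n_gt0 : (0 < n)%N.
  case: n {hgt cgt cn hn htop le_n vanish} Gvan => // Gvan.
  by case: (@homology0_trivial R G); apply: Gvan.
split=> [|FP]; apply: lt_le_trans le_n; first by apply: hd_lt => A m nm; apply: Gvan.
apply: cd_lt => A [|m] nm; first by rewrite leqNgt n_gt0 in nm.
apply: cohomology_vanish_FP; first exact: FP.
by move=> W; apply: Gvan.
Qed.
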